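(* Let $\psi:S^{n-1}\to S^{m-1}$ be an odd continuous map and let $1\le k\le n$. For any linear subspace $L\subseteq\mathbb{R}^m$ of codimension $n-k$ there exists an orthonormal $k$-frame $(e_1,\ldots,e_k)$ in $\mathbb{R}^n$ such that $(\psi(e_1),\ldots,\psi(e_k))$ is an orthonormal $k$-frame in $L$.
   Context: $S^{n-1}\subset\mathbb{R}^n$ and $S^{m-1}\subset\mathbb{R}^m$ are the unit spheres ($n,m\ge 1$); odd means $\psi(-x)=-\psi(x)$ for all $x$. *)

(* Defs.v *)
From HB Require Import structures.
From mathcomp Require Import all_boot all_order all_algebra.
From mathcomp Require Import all_classical all_reals all_analysis.

Set Implicit Arguments.
Unset Strict Implicit.
Unset Printing Implicit Defensive.

Import Order.TTheory GRing.Theory Num.Theory.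
Import numFieldNormedType.Exports.

Local Open Scope classical_set_scope.
Local Open Scope ring_scope.

(* The library's norm on 'rV[R]_n is the sup norm, so the Euclidean structure
   is introduced here; both norms induce the library's topology on 'rV[R]_n. *)
Definition dotv (R : realType) (n : nat) (u v : 'rV[R]_n) : R :=
  \sum_(i < n) u 0 i * v 0 i.

Definition norm_eucl (R : realType) (n : nat) (u : 'rV[R]_n) : R :=
  Num.sqrt (dotv u u).

Definition usphere (R : realType) (n : nat) : set 'rV[R]_n :=
  [set x | norm_eucl x = 1].
Arguments usphere : clear implicits.

Definition orthonormal_frame (R : realType) (n k : nat)
    (e : 'I_k -> 'rV[R]_n) : Prop :=
  forall i j : 'I_k, dotv (e i) (e j) = (i == j)%:R.

(* Main.v *)
(* Extend [psi] radially and, for a k x n matrix X with rows x_i, let Y be the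
   matrix with rows psi(x_i) and N a linear map with kernel L.  The equations
   X X^T = 1, (Y Y^T)_ij = 0 for i <> j and Y N = 0 are kn equations in kn
   unknowns, equivariant under signed permutations of the rows, and their
   solutions are the required frames.  The number of orbits of solutions of such
   an equivariant system is odd, whatever the odd map.

   This is proved for generic piecewise affine approximations on the alcoves of
   type C, which the group permutes.  It acts freely away from the matrices having
   a zero row or two rows equal up to sign, near which X X^T = 1 already fails.
   Among d + 2 vectors in general position in dimension d, an even number of
   subfamilies of d + 1 contain 0 in the interior of their convex hull; changing
   the values at all vertices of a given rank therefore changes the number of
   orbits of alcoves containing a zero by a number which is even, because adjacent
   alcoves pair up its terms.  Finally, when Y Y^T is replaced by X_l D X_l^T, with
   X_l the first k columns and D diagonal with distinct eigenvalues, and Y N by the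
   other columns, the solutions are the frames of signed coordinate axes: a single,
   nondegenerate, orbit. *)

Require Import Defs.
From HB Require Import structures.
From mathcomp Require Import all_boot all_order all_algebra.
From mathcomp Require Import all_classical all_reals all_analysis.
From mathcomp Require Import fingroup perm zify ring lra.

Set Implicit Arguments.
Unset Strict Implicit.
Unset Printing Implicit Defensive.

Import Order.TTheory GRing.Theory Num.Theory.
Import numFieldNormedType.Exports.

Local Open Scope classical_set_scope.
Local Open Scope ring_scope.

(** * Positive dependences in general position *)

(** The alcoves form the barycentric subdivision of a cubic lattice, so every permutation and sign
    change of the coordinates preserves them. The number of odd entries of a vertex is an invariant
    rank, and an alcove has one vertex of each rank. Hence two vertices of one alcove never share an
    orbit, and values chosen independently on the free orbits are generic on alcoves: this
    reconciles general position with equivariance. The radial extension need not be continuous at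
    matrices with a zero row, so nothing is asked of the last two blocks of equations there; the
    Gram block, common to both systems, keeps such alcoves away from 0 by itself. The quadratic
    system vanishes exactly at vertices of the grid, where many alcoves meet. Moving each zero to
    the barycentre of one alcove makes the count stable under perturbation. If no frame existed,
    compactness would give on each small alcove a signed coordinate bounded below by a uniform
    constant, which excludes a zero of any small enough perturbation. *)

Lemma odd_card_involution (T : finType) (P : pred T) (f : T -> T) :
    (forall x, P x -> P (f x)) -> (forall x, P x -> f (f x) = x) ->
    (forall x, P x -> f x != x) ->
  odd #|P| = false.
Proof.
move: {2}#|P| (leqnn #|P|) => m; elim: m P => [|m IHm] P leP Pf fK fN.
  by move: leP; rewrite leqn0 => /eqP ->.
case: (pickP P) => [x Px|/eq_card0 -> //].
pose Q := [pred y | [&& P y, y != x & y != f x]].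
have cardP : #|P| = #|Q|.+2.
  rewrite (cardD1 x) (cardD1 (f x)) !inE !unfold_in Px Pf // fN //=.
  congr _.+2; apply: eq_card => y; rewrite !inE !unfold_in /=.
  by case: (P y); rewrite ?andbF // !andbT andbC.
rewrite cardP /= negbK; apply: (IHm Q).
- by rewrite cardP in leP; exact: ltnW.
- move=> y /and3P[Py yx yfx]; rewrite /Q /= Pf //=; apply/andP; split.
    by apply: contraNneq yfx => <-; rewrite fK.
  by apply: contraNneq yx => e; rewrite -(fK _ Py) e fK.
- by move=> y /and3P[Py _ _]; exact: fK.
- by move=> y /and3P[Py _ _]; exact: fN.
Qed.

Section PositiveDependence.
Variables (R : realFieldType) (W : vectType R).

(** Strict positivity places 0 in the open simplex spanned by the vectors. For [d + 1] vectors in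
    general position in dimension [d], no zero lies on a proper face. *)
Definition pos_dep (I : finType) (P : pred I) (w : I -> W) : Prop :=
  exists c : I -> R,
    (forall i, P i -> 0 < c i) /\ \sum_(i | P i) c i *: w i = 0.

Lemma free_map_eq0 (I : eqType) (w : I -> W) (s : seq I) (c : I -> R) :
    free [seq w i | i <- s] -> \sum_(i <- s) c i *: w i = 0 ->
  forall i, i \in s -> c i = 0.
Proof.
elim: s => [//|j s IHs] /=; rewrite free_cons => /andP[wjN free_s].
rewrite big_cons => sum0.
have cj0 : c j = 0.
  apply: contraNeq wjN => cj0; rewrite -(scalerK cj0 (w j)) memvZ //.
  rewrite (eqP (_ : c j *: w j == - \sum_(i <- s) c i *: w i)); last first.
    by rewrite -addr_eq0 sum0.
  rewrite memvN big_seq memv_suml // => i si.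
  by rewrite memvZ // memv_span // map_f.
move=> i; rewrite inE => /predU1P[->//|]; apply: IHs => //.
by move: sum0; rewrite cj0 scale0r add0r.
Qed.

Lemma span_map_sum (I : eqType) (w : I -> W) (s : seq I) v :
    uniq s -> v \in <<[seq w i | i <- s]>>%VS ->
  exists c : I -> R, v = \sum_(i <- s) c i *: w i.
Proof.
elim: s v => [|j s IHs] v /=.
  by rewrite span_nil memv0 => _ /eqP ->; exists (fun=> 0); rewrite big_nil.
case/andP=> jNs us; rewrite span_cons => /memv_addP[x /vlineP[a ->]] [y].
case/(IHs _ us)=> c -> ->; exists (fun i => if i == j then a else c i).
rewrite big_cons eqxx; congr (_ + _); apply: eq_big_seq => i si.
by case: eqP => // eij; rewrite -eij si in jNs.
Qed.

(* The nonnegative dependences of [d + 2] vectors in general position in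
   dimension [d] form a cone over a segment (or [0]), whose two ends have
   exactly one vanishing coefficient each. *)
Lemma odd_card_pos_dep (I : finType) (U : {vspace W}) (w : I -> W) :
    #|I| = (\dim U).+2 -> (forall i, w i \in U) ->
    (forall s : seq I, uniq s -> size s = \dim U -> free [seq w i | i <- s]) ->
  odd #|[pred i | `[< pos_dep (predC1 i) w >]]| = false.
Proof.
move=> cardI wU gp.
pose others (i j : I) := enum [predD1 predC1 i & j].
have size_others i j : i != j -> size (others i j) = \dim U.
  move=> ij; rewrite -cardE; have := cardC1 i;
    rewrite (cardD1 j (predC1 i)) !inE.
  by rewrite eq_sym ij cardI => -[].
have others_dep (i j : I) (c : I -> R) : i != j -> c i = 0 -> c j = 0 ->
    \sum_i c i *: w i = \sum_(l <- others i j) c l *: w l.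
  move=> ij ci cj; rewrite (bigD1 i) //= ci scale0r add0r.
  rewrite (bigD1 j) 1?eq_sym //= cj scale0r add0r big_enum /=.
  by apply: eq_bigl => l; rewrite !inE andbC.
have gp2 (i j : I) (c : I -> R) : i != j -> c i = 0 -> c j = 0 ->
    \sum_i c i *: w i = 0 -> forall l, c l = 0.
  move=> ij ci cj; rewrite (others_dep i j) // => /free_map_eq0 c0 l.
  have [->//|li] := eqVneq l i; have [->//|lj] := eqVneq l j.
  apply: c0; last by rewrite mem_enum !inE li lj.
  by apply: gp; rewrite ?enum_uniq ?size_others.
have dep1 (i : I) : exists c : I -> R, c i = 1 /\ \sum_i c i *: w i = 0.
  have [j ij] : exists j, i != j.
    have := cardC1 i; rewrite cardI /= => c1.
    have /card_gt0P[j] : (0 < #|predC1 i|)%N by rewrite c1.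
    by rewrite !inE eq_sym => ?; exists j.
  have Us : <<[seq w l | l <- others i j]>>%VS = U.
    apply/eqP; rewrite eqEdim; apply/andP; split.
      by apply/span_subvP => _ /mapP[l _ ->].
    have := gp (others i j) (enum_uniq _) (size_others i j ij).
    by rewrite /free => /eqP ->; rewrite size_map size_others.
  have := wU i; rewrite -Us => /(span_map_sum (enum_uniq _))[c wi].
  pose c' l := if l == i then 1 else if l == j then 0 else - c l.
  exists c'; split; first by rewrite /c' eqxx.
  rewrite (bigD1 i) //= (bigD1 j) 1?eq_sym //= /c' !eqxx eq_sym (negPf ij).
  rewrite scale1r scale0r add0r wi big_enum /=.
  rewrite (eq_bigl (fun l => (l != i) && (l != j))); last first.
    by move=> l; rewrite !inE andbC.
  rewrite -big_split /= big1 // => l /andP[/negPf -> /negPf ->].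
  by rewrite scaleNr subrr.
have ends i : pos_dep (predC1 i) w ->
    exists2 j, j != i & forall l, pos_dep (predC1 l) w <-> l = i \/ l = j.
  case=> a0 [a0_gt0 a0_dep]; pose a l := if l == i then 0 else a0 l.
  have ai : a i = 0 by rewrite /a eqxx.
  have a_gt0 l : l != i -> 0 < a l.
    by move=> li; rewrite /a (negPf li) a0_gt0.
  have a_dep : \sum_l a l *: w l = 0.
    rewrite (bigD1 i) //= ai scale0r add0r -[RHS]a0_dep; apply: eq_bigr => l.
    by rewrite /a => /negPf ->.
  have [b [bi b_dep]] := dep1 i.
  have [j0 j0i] : exists j, j != i.
    have /card_gt0P[j ji] : (0 < #|predC1 i|)%N.
      by have := cardC1 i; rewrite cardI /= => ->.
    by exists j.
  (* Walk from the dependence [b] in the direction [a]: the largest [r l] is the first multiple at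
     which all coefficients are nonnegative, and the one at [j] vanishes there. This is the second
     end of the segment. *)
  pose r l := - b l / a l.
  pose j := [arg max_(l > j0 | l != i) r l]%O.
  have [ji rj] : j != i /\ forall l, l != i -> r l <= r j.
    by rewrite /j; case: arg_maxP => // l li rl; split.
  pose c l := b l + r j * a l.
  have ci : c i = 1 by rewrite /c ai mulr0 addr0.
  have cj : c j = 0.
    by rewrite /c /r mulrAC -mulrA divff ?mulr1 ?subrr // gt_eqF ?a_gt0.
  have c_dep : \sum_l c l *: w l = 0.
    under eq_bigr do rewrite /c scalerDl -scalerA.
    by rewrite big_split /= b_dep -scaler_sumr a_dep scaler0 addr0.
  have c_ge0 l : 0 <= c l.
    have [->|li] := eqVneq l i; first by rewrite ci.
    rewrite /c -lerBlDl sub0r -ler_pdivrMr ?a_gt0 //.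
    by have := rj _ li; rewrite /r.
  exists j => // l; split=> [[e0 [e0_gt0 e0_dep]]|[->|->]]; last 2 first.
  - by exists a0.
  - exists c; split=> [l' l'j|].
      rewrite lt_neqAle c_ge0 andbT eq_sym; apply/negP => /eqP cl'.
      have := gp2 _ _ _ l'j cl' cj c_dep i.
      by rewrite ci => /eqP; rewrite oner_eq0.
    by rewrite [RHS](_ : _ = \sum_l c l *: w l) // [RHS](bigD1 j) //= cj
      scale0r add0r.
  have [->|li] := eqVneq l i; [by left | right].
  pose e l' := if l' == l then 0 else e0 l' / e0 i.
  have e0i : 0 < e0 i by apply: e0_gt0; rewrite inE eq_sym.
  have ei : e i = 1.
    by rewrite /e eq_sym (negPf li) divff // gt_eqF.
  have el : e l = 0 by rewrite /e eqxx.
  have e_gt0 l' : l' != l -> 0 < e l'.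
    by move=> l'l; rewrite /e (negPf l'l) divr_gt0 // e0_gt0.
  have e_dep : \sum_l e l *: w l = 0.
    rewrite (bigD1 l) //= el scale0r add0r.
    rewrite (eq_bigr (fun l' => (e0 i)^-1 *: (e0 l' *: w l'))) => [|l' l'l].
      by rewrite -scaler_sumr e0_dep scaler0.
    by rewrite scalerA /e (negPf l'l) mulrC.
  apply/eqP; apply: contraT => lj.
  (* [e - c] vanishes at [i], hence is a multiple of [a] of constant sign. *)
  have prop l' : (e l - c l) * a l' = a l * (e l' - c l').
    pose f l' := a l * (e l' - c l') - (e l - c l) * a l'.
    have f_dep : \sum_l' f l' *: w l' = 0.
      rewrite /f; move: (e l - c l) => t.
      under eq_bigr do rewrite scalerBl -!scalerA scalerBl.
      by rewrite sumrB -!scaler_sumr sumrB e_dep c_dep a_dep subrr !scaler0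
        subrr.
    have /eqP : f l' = 0.
      apply: (gp2 i l f _ _ _ f_dep); rewrite 1?eq_sym // /f.
        by rewrite ei ci ai subrr !mulr0 subrr.
      by rewrite mulrC subrr.
    by rewrite subr_eq0 eq_sym => /eqP.
  have := prop j; rewrite el cj sub0r subr0 => /eqP.
  have cl_gt0 : 0 < c l.
    rewrite lt_neqAle c_ge0 andbT eq_sym; apply/negP => /eqP cl.
    have := gp2 _ _ _ lj cl cj c_dep i.
    by rewrite ci => /eqP; rewrite oner_eq0.
  have : - c l * a j < a l * e j.
    apply: (@lt_trans _ _ 0); last by rewrite mulr_gt0 ?a_gt0 ?e_gt0 // eq_sym.
    by rewrite nmulr_rlt0 ?a_gt0 // oppr_lt0.
  by move/lt_eqF ->.
case: (pickP [pred i | `[< pos_dep (predC1 i) w >]]) =>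
  [i /asboolP|/eq_card0 -> //].
move=> /ends[j ji char].
rewrite (eq_card (_ : _ =i pred2 i j)) ?card2 1?eq_sym ?ji // => l.
rewrite !inE; apply/asboolP/orP => [/char[->|->]|[/eqP ->|/eqP ->]];
  rewrite ?eqxx; by [left|right|apply/char; left|apply/char; right].
Qed.

End PositiveDependence.

(** * Alcoves of type C *)

Section Flags.
Variables d L : nat.

(* An alcove of the affine Weyl group of type C_d: [vert s 0] has even entries,
   and the entries are then moved by one in the order given by the ranks. *)
Definition flag :=
  ({ffun 'I_d -> 'I_(L.*2.+1)} * {ffun 'I_d -> bool} * {perm 'I_d})%type.

(** The vertices are the barycentres of a complete chain of faces of a cube of side 2 with even
    corners; the face of dimension [j] gives a point with exactly [j] odd entries. *)
Definition vert (s : flag) (j : nat) : 'rV[int]_d :=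
  \row_l (((s.1.1 l)%:Z - L%:Z) *+ 2 + (-1) ^+ s.1.2 l * (s.2 l < j)%:R).

(* The only other possible [j]-th vertex of an alcove with vertices [p]. *)
Definition reflv (p : nat -> 'rV[int]_d) (j : nat) : 'rV[int]_d :=
  if j == 0 then p 1 *+ 2 - p 0 else
  if j == d then p d.-1 *+ 2 - p d else p j.-1 + p j.+1 - p j.

Lemma vert_step (s : flag) (j j' : nat) l :
  (`|vert s j 0 l - vert s j' 0 l| <= 1)%R.
Proof.
rewrite !mxE; case: (s.1.2 l); rewrite ?expr0 ?expr1;
  case: (s.2 l < j)%N; case: (s.2 l < j')%N => /=; lia.
Qed.

Lemma vert_bound (s : flag) (j : nat) l : (`|vert s j 0 l| <= L.*2.+1%:Z)%R.
Proof.
rewrite !mxE; have := ltn_ord (s.1.1 l); case: (s.1.2 l); rewrite ?expr0 ?expr1;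
  case: (s.2 l < j)%N => /=; lia.
Qed.

Lemma vert_reflv_neq (s : flag) j : (0 < d)%N -> (j <= d)%N ->
  reflv (vert s) j != vert s j.
Proof.
move=> d_gt0 jd.
have pj : (j.-1 < d)%N by lia.
apply/negP => /eqP/rowP/(_ ((s.2^-1)%g (Ordinal pj))).
rewrite /reflv; case: eqP => j0; last case: eqP => j1;
  rewrite !mxE !permKV /=; case: (s.1.2 _); rewrite ?expr0 ?expr1; lia.
Qed.

(** Reflecting an inner vertex swaps the ranks [j.-1] and [j]; reflecting the last one flips the
    sign of the coordinate moved last. Only for [j = 0] does the even corner itself move, by two in
    the coordinate moved first, hence the condition that keeps it in the box. *)
Lemma reflv_exists (s : flag) j : (0 < d)%N -> (j <= d)%N ->
    (j = 0 -> forall l, (`|vert s 1 0 l| < L.*2%:Z)%R) ->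
  exists t : flag, forall i, (i <= d)%N ->
    vert t i = if i == j then reflv (vert s) j else vert s i.
Proof.
move=> d_gt0 jd inner; case: s inner => -[a s] r inner; rewrite /reflv.
have [j0|j0] := eqVneq j 0%N.
  move: inner => /(_ j0) inner; subst j.
  pose l0 := (r^-1)%g (Ordinal d_gt0).
  have rl0 l : (r l == 0 :> nat) = (l == l0).
    by rewrite -(inj_eq (@perm_inj _ r)) /l0 permKV.
  have a'P : ((if s l0 then (a l0).-1 else (a l0).+1) < L.*2.+1)%N.
    have := inner l0; rewrite !mxE /= /l0 permKV /=; have := ltn_ord (a l0).
    by rewrite /l0; case: (s _); rewrite ?expr0 ?expr1; lia.
  have al0 : s l0 -> (0 < a l0)%N.
    have := inner l0; rewrite !mxE /= /l0 permKV /= => + sl.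
    by rewrite sl expr1; lia.
  pose a' := [ffun l => if l == l0 then Ordinal a'P else a l].
  pose s' := [ffun l => s l (+) (l == l0)].
  exists (a', s', r) => i id; apply/rowP => l.
  rewrite !mxE /= !ffunE; have := rl0 l.
  case: (eqVneq l l0) => [->|ll] rl; rewrite ?addbT ?addbF.
    move/eqP: rl => rl; case: (eqVneq i 0%N) => i0; rewrite !mxE /= rl.
      by rewrite i0 /=; move: al0; case: (s l0) => /= al0;
        rewrite ?expr0 ?expr1; lia.
    by rewrite lt0n i0; move: al0; case: (s l0) => /= al0;
      rewrite ?expr0 ?expr1; lia.
  move/negbT: rl => rl; case: (eqVneq i 0%N) => i0; rewrite !mxE //= i0.
  have -> : (r l < 1)%N = false by lia.
  rewrite !ltn0 /=; case: (s l); rewrite ?expr0 ?expr1 /=; lia.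
have [j1|j1] := eqVneq j d.
  subst j; have pd : (d.-1 < d)%N by lia.
  pose l0 := (r^-1)%g (Ordinal pd).
  have rl0 l : (r l == d.-1 :> nat) = (l == l0).
    by rewrite -(inj_eq (@perm_inj _ r)) /l0 permKV.
  pose s' := [ffun l => s l (+) (l == l0)].
  exists (a, s', r) => i id; apply/rowP => l.
  rewrite !mxE /= !ffunE; have := rl0 l; have := ltn_ord (r l).
  case: (eqVneq l l0) => ll rd rl; rewrite ?addbT ?addbF.
    move/eqP: rl => rl; case: (eqVneq i d) => ij; rewrite !mxE /= rl.
      rewrite ij pd ltnn; case: (s l); rewrite ?expr0 ?expr1 /=; lia.
    have -> : (d.-1 < i)%N = false by lia.
    by rewrite !mulr0.
  move/negbT: rl => rl; case: (eqVneq i d) => ij; rewrite !mxE //= ij rd.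
  have -> : (r l < d.-1)%N = true by lia.
  case: (s l); rewrite ?expr0 ?expr1 /=; lia.
have pu : (j.-1 < d)%N by lia.
have pv : (j < d)%N by lia.
exists (a, s, (r * tperm (Ordinal pu) (Ordinal pv))%g) => i id.
apply/rowP => l; rewrite !mxE /= permM.
case: tpermP => [rl|rl|/eqP ru /eqP rv]; rewrite ?rl /=.
- case: (eqVneq i j) => ij; rewrite !mxE /= ?rl /=.
    have -> : (j < i)%N = false by lia. have ->
      : (j.-1 < j.-1)%N = false by lia.
    have -> : (j.-1 < j.+1)%N = true by lia. have ->
      : (j.-1 < j)%N = true by lia.
    by rewrite !mulr0 addr0 mulr1; ring.
  by have -> : (j < i)%N = (j.-1 < i)%N by lia.
- case: (eqVneq i j) => ij; rewrite !mxE /= ?rl /=.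
    have -> : (j.-1 < i)%N = true by lia. have -> : (j < j.-1)%N = false by lia.
    have -> : (j < j.+1)%N = true by lia. have -> : (j < j)%N = false by lia.
    by rewrite !mulr0 addr0 mulr1; ring.
  by have -> : (j.-1 < i)%N = (j < i)%N by lia.
case: (eqVneq i j) => ij; rewrite !mxE //=; subst i.
move: ru rv; rewrite -!val_eqE /= => ru rv.
have -> : (r l < j.-1)%N = (r l < j)%N by lia.
have -> : (r l < j.+1)%N = (r l < j)%N by lia.
by ring.
Qed.

End Flags.

(** * Parity of the number of zero flags *)

Section ParityOfZeroFlags.
Variables (R : realFieldType) (W : vectType R) (d L : nat) (U : {vspace W}).
Hypotheses (d_gt0 : (0 < d)%N) (dimU : \dim U = d).
Variables (G : Type) (one : G) (mul : G -> G -> G) (inv : G -> G).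
Variables (aD : G -> 'rV[int]_d -> 'rV[int]_d) (aT : G -> 'End(W)).
Hypotheses (aD1 : forall v, aD one v = v)
  (aDM : forall g h v, aD (mul g h) v = aD g (aD h v))
  (aDV : forall g v, aD (inv g) (aD g v) = v)
  (aDB : forall g u v, aD g (u - v) = aD g u - aD g v).
Variables (good : 'rV[int]_d -> Prop) (F : bool -> 'rV[int]_d -> W).
Hypotheses
  (good_free : forall g v, good v -> aD g v = v -> forall u, aD g u = u)
  (good_inner : forall v, good v -> forall l, (`|v 0 l| < L.*2%:Z)%R)
  (F_in : forall b v, good v -> F b v \in U)
  (F_equiv : forall b g v, good v -> F b (aD g v) = aT g (F b v))
  (F_sep : forall s : flag d L,
     (exists i : 'I_d.+1, ~ good (vert s i)) ->
     exists f : 'Hom(W, R^o), forall b (i : 'I_d.+1), 0 < f (F b (vert s i)))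
  (F_gen : forall s : flag d L, (forall i : 'I_d.+1, good (vert s i)) ->
     forall x : seq ('I_d.+1 * bool), uniq x -> size x = d ->
     free [seq F y.2 (vert s y.1) | y : 'I_d.+1 * bool <- x]).

(** A relation rather than an action, since the image of a flag under [aD] is not assumed to be a
    flag of the same box. *)
Definition flag_equiv (s t : flag d L) : Prop :=
  exists g, forall i : 'I_d.+1, vert t i = aD g (vert s i).

Lemma flag_equiv_refl s : flag_equiv s s.
Proof. by exists one => i; rewrite aD1. Qed.

Lemma flag_equiv_sym s t : flag_equiv s t -> flag_equiv t s.
Proof. by case=> g st; exists (inv g) => i; rewrite st aDV. Qed.

Lemma flag_equiv_trans s t u :
  flag_equiv s t -> flag_equiv t u -> flag_equiv s u.
Proof. by case=> g st [h tu]; exists (mul h g) => i; rewrite tu st aDM. Qed.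

(** Orbits of flags are counted as fixed points of this canonical choice. *)
Definition flag_rep (s : flag d L) : flag d L :=
  choose (fun t => `[< flag_equiv s t >]) s.

Lemma flag_repP s : flag_equiv s (flag_rep s).
Proof.
by apply/asboolP/(@chooseP _ (fun t =>
  `[< flag_equiv s t >]) s)/asboolP/flag_equiv_refl.
Qed.

Lemma flag_rep_eq s t : flag_equiv s t -> flag_rep s = flag_rep t.
Proof.
move=> st; rewrite /flag_rep.
rewrite (@eq_choose _ _ (fun u => `[< flag_equiv t u >])) => [|u].
  by apply: choose_id; apply/asboolP;
    [exact: flag_equiv_sym | exact: flag_equiv_refl].
apply/asbool_equiv_eq; split; apply: flag_equiv_trans => //.
exact: flag_equiv_sym.
Qed.

(** As [l] runs from 0 to [d.+1], the values pass from [F false] to [F true], one rank at a time. *)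
Definition zero_flag (l : nat) (s : flag d L) : Prop :=
  pos_dep xpredT (fun i : 'I_d.+1 => F (i < l)%N (vert s i)).

Definition zero_reps (l : nat) : pred (flag d L) :=
  [pred s | (flag_rep s == s) && `[< zero_flag l s >]].

(* [F true] up to rank [l] and [F false] from rank [l] on, vertex [l] occurring
   twice: omitting either copy gives [zero_flag l] or [zero_flag l.+1]. *)
Let prism (l : nat) (s : flag d L) (x : 'I_d.+2) : W :=
  F (x <= l)%N (vert s (if (x <= l)%N then x : nat else x.-1)).

Let facet l (x : 'I_d.+2) s := pos_dep (predC1 x) (prism l s).

Lemma pos_dep_lift n (x : 'I_n.+1) (w : 'I_n.+1 -> W) :
  pos_dep (predC1 x) w <-> pos_dep xpredT (fun i => w (lift x i)).
Proof.
have bigE (c : 'I_n.+1 -> R) : \sum_(i | predC1 x i) c i *: w i =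
    \sum_i c (lift x i) *: w (lift x i).
  rewrite big_mkcond (bigD1_ord x) //= eqxx add0r.
  by apply: eq_bigr => i _; rewrite eq_sym neq_lift.
split=> -[c [c_gt0 c_dep]].
  exists (fun i => c (lift x i)); rewrite -bigE; split=> // i _.
  by apply: c_gt0; rewrite /= eq_sym neq_lift.
exists (fun i => if unlift x i is Some j then c j else 0); rewrite bigE.
split=> [i|]; last by under eq_bigr do rewrite liftK.
by rewrite /= eq_sym => /unlift_some[j -> ->]; exact: c_gt0.
Qed.

Let facet_low l s (x : 'I_d.+2) : x = l :> nat -> facet l x s <-> zero_flag l s.
Proof.
move=> xl; apply: (iff_trans (pos_dep_lift _ _)).
rewrite /zero_flag; set w1 := (X in pos_dep _ X);
  set w2 := (X in _ <-> pos_dep _ X).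
suff -> : w1 = w2 by [].
apply/funext => i; rewrite /w1 /w2 /prism /= /bump xl.
have [li|il] := leqP l i; rewrite ?add0n ?add1n.
  by rewrite ltnNge li.
by rewrite ltnW.
Qed.

Let facet_high l s (x : 'I_d.+2) :
  x = l.+1 :> nat -> facet l x s <-> zero_flag l.+1 s.
Proof.
move=> xl; apply: (iff_trans (pos_dep_lift _ _)).
rewrite /zero_flag; set w1 := (X in pos_dep _ X);
  set w2 := (X in _ <-> pos_dep _ X).
suff -> : w1 = w2 by [].
apply/funext => i; rewrite /w1 /w2 /prism /= /bump xl ltnS.
have [li|il] := ltnP l i; rewrite ?add0n ?add1n.
  by rewrite leqNgt ltnS ltnW // leqNgt li.
by rewrite il.
Qed.

Let prism_idx (l : nat) (x : 'I_d.+2) : (l <= d)%N ->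
  ((if (x <= l)%N then x : nat else x.-1) < d.+1)%N.
Proof. by move=> ld; have := ltn_ord x; case: (leqP x l); lia. Qed.

(** The functional of [F_sep] is positive on all values of a flag with a bad vertex, which excludes
    a positive dependence. Only flags on which the group acts freely are therefore counted. *)
Let facet_good l x s : (l <= d)%N -> facet l x s ->
  forall i : 'I_d.+1, good (vert s i).
Proof.
move=> ld [c [c_gt0 c_dep]] i; apply: contrapT => bad.
have [f fP] : exists f : 'Hom(W, R^o), forall b (i : 'I_d.+1),
  0 < f (F b (vert s i)).
  by apply: F_sep; exists i.
have: f (\sum_(y | predC1 x y) c y *: prism l s y) == 0 by rewrite c_dep
  linear0.
have [z zx] : exists z, predC1 x z.
  have : (0 < #|predC1 x|)%N by rewrite cardC1 card_ord.
  by case/card_gt0P => z zx; exists z.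
rewrite linear_sum (bigD1 z) //= gt_eqF //.
have fp y : 0 < f (prism l s y).
  by have := fP (y <= l)%N (Ordinal (prism_idx y ld)).
have cfp y : predC1 x y -> 0 < f (c y *: prism l s y).
  by move=> yx; rewrite linearZ; apply: mulr_gt0 (fp y); exact: c_gt0.
apply: ltr_pwDl; first exact: cfp.
by apply: sumr_ge0 => y /andP[yx _]; apply/ltW/cfp.
Qed.

Let facet_equiv l x s t : (l <= d)%N -> flag_equiv s t ->
  facet l x s -> facet l x t.
Proof.
move=> ld [g st] fs; have sgood := facet_good ld fs.
case: fs => c [c_gt0 c_dep]; exists c; split=> //.
rewrite (eq_bigr (fun y => aT g (c y *: prism l s y))) => [|y _].
  by rewrite -linear_sum c_dep linear0.
rewrite linearZ /=; congr (_ *: _); rewrite /prism.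
have := st (Ordinal (prism_idx y ld)); have := sgood (Ordinal (prism_idx y ld)).
by move=> /= gs ->; rewrite F_equiv.
Qed.

Lemma zero_flag_equiv l s t : (l <= d)%N -> flag_equiv s t ->
  zero_flag l s -> zero_flag l t.
Proof.
move=> ld st; have ld2 : (l < d.+2)%N by lia.
have lowP u := facet_low u (erefl (Ordinal ld2 : nat)).
by move=> /lowP/(facet_equiv ld st)/lowP.
Qed.

Definition flag_refl (j : nat) (s : flag d L) : flag d L :=
  odflt s [pick t | [forall i : 'I_d.+1,
    vert t i == if i == j :> nat then reflv (vert s) j else vert s i]].

Lemma flag_reflP j s : (j <= d)%N -> (forall i : 'I_d.+1, good (vert s i)) ->
  forall i, (i <= d)%N ->
  vert (flag_refl j s) i = if i == j then reflv (vert s) j else vert s i.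
Proof.
move=> jd sgood; have d1 : (1 < d.+1)%N by [].
have inner : j = 0 -> forall l, (`|vert s 1 0 l| < L.*2%:Z)%R.
  by move=> _; exact: good_inner (sgood (Ordinal d1)).
have [t tP] := reflv_exists d_gt0 jd inner.
rewrite /flag_refl; case: pickP => [u /forallP uP i id|/(_ t)/negP[]].
  by have := uP (inord i); rewrite inordK // => /eqP.
by apply/forallP => i; rewrite tP // -ltnS.
Qed.

Lemma eq_reflv p q j : (j <= d)%N -> (forall i, (i <= d)%N -> p i = q i) ->
  @reflv d p j = reflv q j.
Proof.
by move=> jd pq; rewrite /reflv; case: eqP => j0; last case: eqP => j1;
  rewrite !pq //; lia.
Qed.

Lemma aD_reflv g p j : aD g (reflv p j) = reflv (fun i => aD g (p i)) j.
Proof.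
have aD0 : aD g 0 = 0 by rewrite -{1}(subrr 0) aDB subrr.
have aDD u v : aD g (u + v) = aD g u + aD g v.
  by rewrite -[v in LHS]opprK -[- v]sub0r aDB aDB aD0 sub0r opprK.
by rewrite /reflv; case: eqP => j0; last case: eqP => j1;
  rewrite aDB ?mulr2n aDD.
Qed.

Lemma reflvK p j : (j <= d)%N ->
  reflv (fun i => if i == j then @reflv d p j else p i) j = p j.
Proof.
move=> jd; rewrite /reflv; have [->|j0] := eqVneq j 0%N.
  by rewrite /= opprB addrC subrK.
have [->|j1] := eqVneq j d.
  have -> : (d.-1 == d) = false by lia.
  by rewrite opprB addrC subrK.
have -> : (j.-1 == j) = false by lia.
have -> : (j.+1 == j) = false by lia.
by rewrite eqxx opprB addrC subrK.
Qed.

(** Such a facet omits the vertex of rank [j] altogether, so it is shared with the alcove reflected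
    at [j]. The pairing descends to orbits. *)
Let facet_parity l (x : 'I_d.+2) : (l <= d)%N -> x != l :> nat ->
    x != l.+1 :> nat ->
  odd #|[pred s | (flag_rep s == s) && `[< facet l x s >]]| = false.
Proof.
(* Past the doubled vertex [l], positions in the prism run one ahead of ranks. *)
move=> ld xl xl1; pose j := if (x < l)%N then x : nat else x.-1.
have jd : (j <= d)%N by have := ltn_ord x; rewrite /j; case: (ltnP x l); lia.
have facet_refl s : facet l x s -> facet l x (flag_refl j s).
  move=> fs; have sgood := facet_good ld fs.
  case: fs => c [c_gt0 c_dep]; exists c; split=> //.
  rewrite -[RHS]c_dep; apply: eq_bigr => y yx; congr (_ *: _); rewrite /prism.
  rewrite flag_reflP //; last by have := prism_idx y ld.
  case: eqP => // ej; move: yx ej; rewrite /= -val_eqE /= /j.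
  by case: (leqP y l); case: (ltnP x l); lia.
have refl2 s : facet l x s ->
    flag_equiv (flag_refl j (flag_rep (flag_refl j s))) s.
  move=> fs; have sgood := facet_good ld fs.
  have [g tg] := flag_repP (flag_refl j s).
  have ft : facet l x (flag_rep (flag_refl j s)).
    by apply: facet_equiv (flag_repP _) _ => //; exact: facet_refl.
  apply: flag_equiv_sym; exists g => -[i id] /=.
  rewrite flag_reflP //; last exact: facet_good ft.
  case: eqP => [->|ij].
    rewrite (@eq_reflv _ (fun i => aD g (vert (flag_refl j s) i))) //;
      last first.
      by move=> i' i'd; exact: tg (Ordinal (i'd : (i' < d.+1)%N)).
    rewrite -aD_reflv; congr (aD g _); rewrite -[RHS](reflvK (vert s) jd).
    by apply: eq_reflv => // i' i'd; rewrite flag_reflP.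
  rewrite (tg (Ordinal id)) /= flag_reflP //.
  by case: eqP.
apply: (@odd_card_involution _ _ (fun s => flag_rep (flag_refl j s))).
- move=> s /andP[_ /asboolP fs]; apply/andP; split.
    by apply/eqP/esym/flag_rep_eq/flag_repP.
  by apply/asboolP; apply: facet_equiv (flag_repP _) _ => //; exact: facet_refl.
- by move=> s /andP[/eqP srep /asboolP fs]; rewrite (flag_rep_eq (refl2 s fs)).
move=> s /andP[/eqP srep /asboolP fs]; have sgood := facet_good ld fs.
apply/eqP => es; have := flag_repP (flag_refl j s); rewrite es => -[g gP].
(* If a flag were equivalent to its reflection, the group element would fix a vertex of rank other
   than [j]; being good, that vertex forces it to act trivially, although the reflection moves
   vertex [j]. *)
have [i ij] : exists i : 'I_d.+1, i != j :> nat.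
  case: (eqVneq j 0%N) => j0; last by exists ord0; rewrite eq_sym.
  by exists ord_max; rewrite /= j0; lia.
have gid : forall u, aD g u = u.
  apply: (good_free (sgood i)); rewrite [RHS]gP flag_reflP ?(negPf ij) //.
  by rewrite -ltnS.
have := vert_reflv_neq s d_gt0 jd.
have := gP (Ordinal (jd : (j < d.+1)%N)); rewrite gid /= flag_reflP // eqxx.
by move=> <-; rewrite eqxx.
Qed.

Let prism_parity l s : (l <= d)%N ->
  odd #|[pred x | `[< facet l x s >]]| = false.
Proof.
move=> ld; have [sgood|] := pselect (forall i : 'I_d.+1, good (vert s i));
  last first.
  move=> sbad; rewrite eq_card0 // => x; rewrite !inE; apply/asboolP => fs.
  by apply: sbad; exact: facet_good fs.
pose idx (x : 'I_d.+2) := (Ordinal (prism_idx x ld), (x <= l)%N).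
have idx_inj : injective idx.
  move=> x y [] exy bxy; apply/val_inj => /=; move: exy bxy.
  by case: (leqP x l); case: (leqP y l) => //= *; lia.
apply: (@odd_card_pos_dep _ _ _ U); rewrite ?card_ord ?dimU //.
  by move=> x; apply: F_in; exact: sgood (idx x).1.
move=> x ux sx; have := F_gen sgood (x := [seq idx i | i <- x]).
by rewrite map_inj_uniq // size_map -map_comp; apply.
Qed.

(** Double counting of pairs of an orbit and a facet of its prism: each prism contributes an even
    number, and so does each position other than the two copies of vertex [l]. *)
Let zero_reps_step l : (l <= d)%N ->
  odd #|zero_reps l| = odd #|zero_reps l.+1|.
Proof.
move=> ld.
have dl : (l < d.+2)%N by lia. have dl1 : (l.+1 < d.+2)%N by lia.
pose m x := #|[pred s | (flag_rep s == s) && `[< facet l x s >]]|.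
have mlow : #|zero_reps l| = m (Ordinal dl).
  apply: eq_card => s; rewrite !inE; congr (_ && _).
  by apply/esym/asbool_equiv_eq; apply: facet_low.
have mhigh : #|zero_reps l.+1| = m (Ordinal dl1).
  apply: eq_card => s; rewrite !inE; congr (_ && _).
  by apply/esym/asbool_equiv_eq; apply: facet_high.
have oddsum (I : finType) (Q : pred I) (f : I -> nat) :
    (forall i, Q i -> odd (f i) = false) -> odd (\sum_(i | Q i) f i) = false.
  by move=> f0; apply: (big_ind (fun t => odd t = false)) => // a b oa ob;
    rewrite oddD oa ob.
have : odd (\sum_x m x) = false.
  rewrite (eq_bigr (fun x => \sum_(s | flag_rep s == s)
    (`[< facet l x s >] : nat))); last first.
    by move=> x _; rewrite /m -sum1_card big_mkcondr.
  rewrite exchange_big /=; apply: oddsum => s _.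
  by rewrite -[RHS](prism_parity s ld) -sum1_card [in RHS]big_mkcond.
rewrite (bigD1 (Ordinal dl)) //= (bigD1 (Ordinal dl1)) /=; last first.
  by rewrite -val_eqE /=; lia.
rewrite !oddD oddsum ?addbF => [|x /andP[]]; last first.
  by rewrite -!val_eqE /= => xl xl1; exact: facet_parity.
by rewrite mlow mhigh; case: (odd _); case: (odd _).
Qed.

Lemma odd_zero_reps : odd #|zero_reps 0| = odd #|zero_reps d.+1|.
Proof.
have H l : (l <= d.+1)%N -> odd #|zero_reps 0| = odd #|zero_reps l|.
  elim: l => [//|l IHl] ld; rewrite -(zero_reps_step ld); exact/IHl/ltnW.
exact: H (leqnn _).
Qed.

End ParityOfZeroFlags.

(** * Generic equivariant perturbations *)

Section GenericChoice.
Variables (R : realFieldType) (W : vectType R) (N : W -> R).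
Hypotheses (N_ge0 : forall v, 0 <= N v)
  (NZ : forall a v, N (a *: v) = `|a| * N v)
  (ND : forall u v, N (u + v) <= N u + N v).

(** Two hits of the line in one [V] would put both [c] and [a] in [V]. So each [V] is hit at most
    once, and it suffices to stop before the first hit. *)
Lemma line_avoid (Vs : seq {vspace W}) (a c : W) (e : R) : 0 < e ->
    (forall V, V \in Vs -> (a \notin V) || (c \notin V)) ->
  exists2 e', 0 < e' <= e & forall t, 0 < t < e' ->
    forall V, V \in Vs -> a + t *: c \notin V.
Proof.
move=> e_gt0; elim: Vs => [|V Vs IHVs] acV; first by exists e;
  rewrite ?e_gt0 /=.
have [|e' /andP[e'_gt0 e'e] avoid] := IHVs.
  by move=> V' V'Vs; apply: acV; rewrite inE V'Vs orbT.
have [[t0 t0P t0V]|noV] :=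
    pselect (exists2 t, 0 < t < e' & a + t *: c \in V); last first.
  exists e'; rewrite ?e'_gt0 // => t tP V'; rewrite inE => /predU1P[->|];
    last exact: avoid.
  by apply/negP => tV; apply: noV; exists t.
move/andP: t0P => [t0_gt0 t0e']; exists t0.
  by rewrite t0_gt0 /= (le_trans (ltW t0e')).
move=> t /andP[t_gt0 tt0] V'; rewrite inE => /predU1P[->|]; last first.
  by apply: avoid; rewrite t_gt0 (lt_trans tt0).
apply/negP => tV; have cV : c \in V.
  have tt0N : t - t0 != 0 by rewrite subr_eq0 lt_eqF.
  rewrite -(scalerK tt0N c) memvZ // scalerBl.
  rewrite (_ : _ - _ = a + t *: c - (a + t0 *: c)) ?memvB //.
  by rewrite opprD addrACA subrr add0r.
have aV : a \in V by rewrite -(addrK (t *: c) a) memvB ?memvZ.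
by have := acV V (mem_head _ _); rewrite aV cV.
Qed.

Lemma avoid_subspaces (U : {vspace W}) (Vs : seq {vspace W}) (a : W) (e : R) :
    0 < e -> a \in U -> (forall V, V \in Vs -> ~~ (U <= V)%VS) ->
  exists b, [/\ b \in U, N (b - a) <= e & forall V, V \in Vs -> b \notin V].
Proof.
move=> + aU; elim: Vs e => [|V Vs IHVs] e e_gt0 UVs.
  by exists a; rewrite subrr -(scale0r a) NZ normr0 mul0r ltW.
have e2_gt0 : 0 < e / 2 by rewrite divr_gt0.
have [|b [bU ba bVs]] := IHVs _ e2_gt0.
  by move=> V' V'Vs; apply: UVs; rewrite inE V'Vs orbT.
have /subvPn[c cU cV] := UVs V (mem_head _ _).
have Nc_gt0 : 0 < N c + 1 by rewrite ltr_wpDl.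
have [||e' /andP[e'_gt0 e'e] avoid] :=
  @line_avoid (V :: Vs) b c (e / 2 / (N c + 1)).
- by rewrite divr_gt0.
- by move=> V'; rewrite inE => /predU1P[->|/bVs ->//]; rewrite cV orbT.
have t_gt0 : 0 < e' / 2 by rewrite divr_gt0.
exists (b + (e' / 2) *: c); split.
- by rewrite memvD ?memvZ.
- rewrite addrAC (le_trans (ND _ _)) // [leRHS]splitr lerD // NZ gtr0_norm //.
  have : e' / 2 <= e / 2 / (N c + 1) by apply: le_trans e'e; lra.
  rewrite ler_pdivlMr // => /(le_trans _); apply.
  by rewrite ler_wpM2l ?ltW // ltrDl.
by apply: avoid; rewrite t_gt0 /=; lra.
Qed.

(** Items stand for vertices, keys for their orbits, and [T i] carries the value at the orbit
    representative to the item. Values are fixed one key at a time, each avoiding the finitely many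
    subspaces that would create a dependence with the earlier ones. *)
Lemma generic_choice (I K : eqType) (key : I -> K) (T : I -> 'End(W))
    (U : {vspace W}) (items : seq I) (u0 : K -> W) (e : R) :
    (forall i, lker (T i) == 0%VS) -> (forall x, u0 x \in U) -> 0 < e ->
  exists u : K -> W, [/\ forall x, u x \in U, forall x, N (u x - u0 x) <= e &
    forall s : seq I, uniq [seq key i | i <- s] -> {subset s <= items} ->
      (size s <= \dim U)%N -> free [seq T i (u (key i)) | i <- s]].
Proof.
move=> Tinj u0U e_gt0; wlog uitems : items / uniq items => [wl|].
  have [u [uU uu0 ufree]] := wl _ (undup_uniq items).
  exists u; split=> // s us ss; apply: ufree => // i /ss.
  by rewrite mem_undup.
suff H (ks : seq K) : exists u : K -> W,
    [/\ forall x, u x \in U, forall x, N (u x - u0 x) <= e &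
    forall s : seq I, uniq [seq key i | i <- s] -> {subset s <= items} ->
      {subset [seq key i | i <- s] <= ks} ->
      (size s <= \dim U)%N -> free [seq T i (u (key i)) | i <- s]].
  have [u [uU uu0 ufree]] := H [seq key i | i <- items].
  exists u; split=> // s us ss; apply: ufree => // _ /mapP[i si ->].
  exact/map_f/ss.
elim: ks => [|x ks [u [uU uu0 ufree]]].
  exists u0; split=> // [y|s _ _ sub _].
    by rewrite subrr -(scale0r (u0 y)) NZ normr0 mul0r ltW.
  by case: s sub => [|i s] sub;
    [exact: nil_free | have := sub (key i) (mem_head _ _)].
have [xks|xNks] := boolP (x \in ks).
  exists u; split=> // s us ss sub; apply: ufree => // y /sub.
  by rewrite inE => /predU1P[->|].
pose spn (s : seq I) := <<[seq T i (u (key i)) | i <- s]>>%VS.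
(* Masks enumerate all sublists of [items]. The filter discards subspaces that cannot be avoided; a
   span of fewer than [\dim U] vectors is never among them, because [T i] is injective. *)
pose Vs := [seq V <- [seq (T i @^-1: spn (mask (m : _.-tuple bool) items))%VS
  | i <- items, m <- enum {: (size items).-tuple bool}] | ~~ (U <= V)%VS].
have [|b [bU bu0 bVs]] := @avoid_subspaces U Vs (u0 x) e e_gt0 (u0U x).
  by move=> V; rewrite mem_filter => /andP[].
pose u' y := if y == x then b else u y.
exists u'; rewrite /u'; split=> [y|y|s us ss sub sd].
- by case: eqP.
- by case: eqP => [->|].
have [/mapP[i si xE]|xNs] := boolP (x \in [seq key i | i <- s]); last first.
  rewrite (_ : [seq _ | i <- s] = [seq T i (u (key i)) | i <- s]); last first.
    by apply/eq_in_map => i si; case: eqP => // ix; rewrite -ix map_f in xNs.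
  apply: ufree => // y ys; have := sub y ys; rewrite inE => /predU1P[yx|//].
  by rewrite yx (negPf xNs) in ys.
have ps := perm_to_rem si; rewrite (perm_free (perm_map _ ps)) /= free_cons.
move: us; rewrite (perm_uniq (perm_map _ ps)) /= => /andP[iN urem].
have E : [seq T j (if key j == x then b else u (key j)) | j <- rem i s] =
         [seq T j (u (key j)) | j <- rem i s].
  apply/eq_in_map => j sj; case: eqP => // jx; rewrite -xE -jx map_f // in iN.
have szs : size s = (size (rem i s)).+1 by rewrite (perm_size ps).
have subr : {subset rem i s <= items} by move=> j /mem_rem/ss.
have free_r : free [seq T j (u (key j)) | j <- rem i s].
  apply: ufree => //; last by rewrite -ltnS -szs ltnW.
  move=> y yr; have : y \in x :: ks.
    by apply: sub; rewrite (perm_mem (perm_map _ ps)) inE yr orbT.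
  by rewrite inE => /predU1P[yx|//]; rewrite yx xE (negPf iN) in yr.
rewrite E free_r andbT -xE eqxx -/(spn _).
pose m := [seq j \in rem i s | j <- items].
have mE : spn (mask m items) = spn (rem i s).
  rewrite /spn; apply: eq_span; apply: perm_mem; apply: perm_map.
  rewrite /m -filter_mask; apply: uniq_perm.
  - exact: filter_uniq.
  - exact: map_uniq urem.
  - by move=> j; rewrite mem_filter andb_idr // => /subr.
have szm : size m == size items by rewrite size_map.
have := bVs (T i @^-1: spn (rem i s))%VS; rewrite -memv_preim; apply.
rewrite mem_filter; apply/andP; split.
  apply/negP => /subvP sUV.
  have : (T i @: U <= spn (rem i s))%VS.
    by apply/subvP => _ /memv_imgP[v vU ->]; have := sUV v vU;
      rewrite -memv_preim.
  move/dimvS; rewrite limg_dim_eq ?(eqP (Tinj i)) ?capv0 //.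
  rewrite leqNgt => /negP; apply; apply: leq_ltn_trans (dim_span _) _.
  by rewrite size_map -szs.
by rewrite -mE; apply: (allpairs_f (fun i (m : (size items).-tuple bool) =>
  _ @^-1: spn (mask m items))%VS
  (ss _ si) (mem_enum _ (Tuple szm))).
Qed.

End GenericChoice.

(** * Transfer of zeros between two equivariant maps *)

Section ZeroFlagTransfer.
Variables (R : realFieldType) (W : vectType R) (d L : nat) (U : {vspace W}).
Hypotheses (d_gt0 : (0 < d)%N) (dimU : \dim U = d).
Variables (N : W -> R).
Hypotheses (N_ge0 : forall v, 0 <= N v)
  (NZ : forall a v, N (a *: v) = `|a| * N v)
  (ND : forall u v, N (u + v) <= N u + N v).
Variables (G : Type) (one : G) (mul : G -> G -> G) (inv : G -> G).
Variables (aD : G -> 'rV[int]_d -> 'rV[int]_d) (aT : G -> 'End(W)).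
Hypotheses (aD1 : forall v, aD one v = v)
  (aDM : forall g h v, aD (mul g h) v = aD g (aD h v))
  (aDV : forall g v, aD (inv g) (aD g v) = v)
  (aDB : forall g u v, aD g (u - v) = aD g u - aD g v)
  (aTM : forall g h w, aT (mul g h) w = aT g (aT h w))
  (aT_inj : forall g, lker (aT g) == 0%VS)
  (aT_in : forall g w, w \in U -> aT g w \in U)
  (aT_le : forall g w, N (aT g w) <= N w).
Variables (good : 'rV[int]_d -> Prop) (rk : 'rV[int]_d -> nat).
Hypotheses
  (good_free : forall g h v, good v -> aD g v = aD h v -> g = h)
  (good_equiv : forall g v, good v -> good (aD g v))
  (good_inner : forall v, good v -> forall l, (`|v 0 l| < L.*2%:Z)%R)
  (rk_equiv : forall g v, rk (aD g v) = rk v)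
  (rk_vert : forall (s : flag d L) (i : 'I_d.+1), rk (vert s i) = i).
Variables (f : bool -> 'rV[int]_d -> W) (e : R).
Hypotheses (e_gt0 : 0 < e)
  (f_in : forall b v, good v -> f b v \in U)
  (f_equiv : forall b g v, good v -> f b (aD g v) = aT g (f b v))
  (f_sep : forall s : flag d L,
     (exists i : 'I_d.+1, ~ good (vert s i)) ->
     exists h : 'Hom(W, R^o), (forall w, `|h w| <= N w) /\
       forall b (i : 'I_d.+1), e < h (f b (vert s i))).

Let same_orbit u v := exists g, v = aD g u.

Let orep (v : 'rV[int]_d) := choose (fun u => `[< same_orbit v u >]) v.

Let same_orbit_refl v : same_orbit v v.
Proof. by exists one; rewrite aD1. Qed.

Let same_orbit_sym u v : same_orbit u v -> same_orbit v u.
Proof. by case=> g ->; exists (inv g); rewrite aDV. Qed.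

Let same_orbit_trans u v w : same_orbit u v -> same_orbit v w -> same_orbit u w.
Proof. by move=> [g ->] [h ->]; exists (mul h g); rewrite aDM. Qed.

Let orepP v : same_orbit v (orep v).
Proof.
apply/asboolP/(@chooseP _ (fun u => `[< same_orbit v u >]) v).
exact/asboolP/same_orbit_refl.
Qed.

Let orep_eq u v : same_orbit u v -> orep u = orep v.
Proof.
move=> uv; rewrite /orep (@eq_choose _ _ (fun w => `[< same_orbit v w >])).
  by apply: choose_id; apply/asboolP => //; exact: same_orbit_sym.
move=> w; apply/asbool_equiv_eq; split; apply: same_orbit_trans => //.
exact: same_orbit_sym.
Qed.

Let mover v := projT1 (cid (same_orbit_sym (orepP v))).

Let moverP v : v = aD (mover v) (orep v).
Proof. exact: projT2 (cid (same_orbit_sym (orepP v))). Qed.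

Let orep_good v : good v -> good (orep v).
Proof. by have [g ->] := orepP v; exact: good_equiv. Qed.

(** Values are perturbed at orbit representatives and transported by the group, consistently because
    good vertices have trivial stabilizers. Vertices of one flag have distinct ranks, hence distinct
    orbits, so [generic_choice] applies to them. *)
Lemma generic_perturbation : exists F : bool -> 'rV[int]_d -> W,
  [/\ forall b v, N (F b v - f b v) <= e,
      forall b v, good v -> F b v \in U,
      forall b g v, good v -> F b (aD g v) = aT g (F b v) &
      forall s : flag d L, (forall i : 'I_d.+1, good (vert s i)) ->
        forall x : seq ('I_d.+1 * bool), uniq x -> size x = d ->
        free [seq F y.2 (vert s y.1) | y : 'I_d.+1 * bool <- x]].
Proof.
(* The value 0 at the other vertices is a placeholder inside [U]; the perturbed map will keep the
   value of [f] there. *)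
pose u0 (x : 'rV[int]_d * bool) := if pselect (good x.1) then f x.2 x.1 else 0.
have u0U x : u0 x \in U.
  by rewrite /u0; case: pselect => gx /=; [exact: f_in | exact: mem0v].
pose key (x : 'rV[int]_d * bool) := (orep x.1, x.2).
pose items : seq ('rV[int]_d * bool) :=
  [seq (vert s y.1, y.2) | s <- enum {: flag d L},
                           y : 'I_d.+1 * bool <- enum {: 'I_d.+1 * bool}].
have [u [uU uu0 ufree]] := generic_choice N_ge0 NZ ND key items
  (fun i => aT_inj (mover i.1)) u0U e_gt0.
exists (fun b v => if pselect (good v) then aT (mover v) (u (orep v,
  b)) else f b v).
split.
- move=> b v; case: pselect => gv /=; last first.
    by rewrite subrr -(scale0r (f b v)) NZ normr0 mul0r ltW.
  rewrite [in f b v](moverP v) f_equiv; last exact: orep_good.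
  rewrite -linearB (le_trans (aT_le _ _)) //.
  by have := uu0 (orep v, b); rewrite /u0 /=; case: pselect => //= -[];
    exact: orep_good.
- move=> b v gv; case: pselect => //= ?.
  exact: aT_in.
- move=> b g v gv; case: pselect => [?|[]] /=; last exact: good_equiv.
  case: pselect => //= ?; have oE : orep (aD g v) = orep v.
    by symmetry; apply: orep_eq; exists g.
  rewrite -aTM oE; congr (aT _ _).
  apply: (good_free (orep_good gv)); rewrite aDM -moverP.
  by rewrite -{1}oE -moverP.
move=> s sgood x ux sx.
pose it (y : 'I_d.+1 * bool) : 'rV[int]_d * bool := (vert s y.1, y.2).
rewrite (_ : [seq _ | y : 'I_d.+1 * bool <- x] =
    [seq aT (mover i.1) (u (key i)) | i <- [seq it y | y <- x]]); last first.
  rewrite -map_comp; by apply: eq_map => y /=; case: pselect => //= -[].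
apply: ufree; last by rewrite size_map sx dimU.
  rewrite -map_comp map_inj_uniq // => -[i b] [j c] [oij ->].
  congr (_, _); apply/val_inj => /=; rewrite -(rk_vert s i) -(rk_vert s j).
  rewrite [in LHS](moverP (vert s i)) [in RHS](moverP (vert s j)).
  by rewrite !rk_equiv oij.
move=> _ /mapP[y yx ->]; rewrite /items.
by apply: (allpairs_f (fun s (y : 'I_d.+1 * bool) => (vert s y.1, y.2)));
  rewrite mem_enum.
Qed.

(** The premise says that near [f false] there is exactly one orbit of zero flags; parity then
    leaves at least one near [f true]. It ranges over all small perturbations because the generic
    one is only obtained in the proof. *)
Lemma zero_flag_transfer :
    (forall F : 'rV[int]_d -> W, (forall v, N (F v - f false v) <= e) ->
      (forall v, good v -> F v \in U) ->
      exists2 s0 : flag d L,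
        pos_dep xpredT (fun i : 'I_d.+1 => F (vert s0 i)) &
        forall s : flag d L, pos_dep xpredT (fun i : 'I_d.+1 => F (vert s i)) ->
        exists g, forall i : 'I_d.+1, vert s i = aD g (vert s0 i)) ->
  exists (s : flag d L) (w : 'I_d.+1 -> W), (forall i, N (w i) <= e) /\
    pos_dep xpredT (fun i : 'I_d.+1 => f true (vert s i) + w i).
Proof.
move=> base; have [F [Ff FU Fequiv Fgen]] := generic_perturbation.
have Fsep (s : flag d L) : (exists i : 'I_d.+1, ~ good (vert s i)) ->
    exists h : 'Hom(W, R^o), forall b (i : 'I_d.+1), 0 < h (F b (vert s i)).
  move=> /f_sep[h [hN hP]]; exists h => b i.
  have -> : F b (vert s i) = f b (vert s i) + (F b (vert s i) - f b (vert s i)).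
    by rewrite addrC subrK.
  have hD x y : h (x + y) = h x + h y :> R by rewrite linearD.
  rewrite hD; have := hN (F b (vert s i) - f b (vert s i)).
  move/le_trans/(_ (Ff _ _)); rewrite ler_norml => /andP[+ _].
  by have := hP b i; lra.
have gfree g v : good v -> aD g v = v -> forall u, aD g u = u.
  by move=> gv gvv u; rewrite (@good_free g one v) ?aD1.
have := odd_zero_reps d_gt0 dimU aD1 aDM aDV aDB gfree good_inner FU Fequiv
  Fsep Fgen.
have [s0 s0P s0u] := base _ (Ff false) (FU false).
have /fintype.eq_card1 -> : @zero_reps R W d L G aD F 0 =i pred1 (flag_rep aD
  s0).
  move=> s; rewrite !inE; have s0r := flag_repP aD1 s0.
  apply/andP/eqP => [[/eqP srep /asboolP sz]|->].
    have s0s : flag_equiv aD s0 s by have [g gP] := s0u s sz; exists g.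
    by rewrite -srep -(flag_rep_eq aD1 aDM aDV s0s).
  split; first by apply/eqP/esym/(flag_rep_eq aD1 aDM aDV).
  apply/asboolP.
  by apply: (zero_flag_equiv d_gt0 dimU Fequiv Fsep (leq0n _) s0r); exact: s0P.
move/esym => odd1; have /card_gt0P[s] : (0 < #|@zero_reps R W d L G aD F
  d.+1|)%N.
  by case: #|_| odd1.
rewrite !inE => /andP[_ /asboolP sz].
exists s, (fun i => F true (vert s i) - f true (vert s i)); split=> [i|].
  exact: Ff.
move: sz; rewrite /zero_flag; set w1 := (X in pos_dep _ X).
set w2 := (X in _ -> pos_dep _ X); suff -> : w1 = w2 by [].
by apply/funext => i; rewrite /w1 /w2 ltn_ord addrC subrK.
Qed.

End ZeroFlagTransfer.

(** * Signed permutations *)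

Section SignedPermutations.
Variable k : nat.

(** An integral row of square sum 1 has a single nonzero entry, equal to 1 or -1, so integral
    orthogonal matrices are the signed permutations. In this encoding the group laws are matrix
    identities. *)
Definition sperm := {P : 'M[int]_k | P *m P^T == 1%:M}.

Definition signed_perm (P : 'M[int]_k) (p : 'I_k -> 'I_k) (s : 'I_k -> int) :=
  [/\ injective p, forall i, s i = 1 \/ s i = -1 &
      forall i j, P i j = if j == p i then s i else 0].

Lemma sperm_VK (P : sperm) : (val P)^T *m val P = 1%:M.
Proof. by apply: mulmx1C; exact/eqP/(valP P). Qed.

Lemma sum_sqr_int_eq1 (x : 'I_k -> int) : \sum_i x i ^+ 2 = 1 ->
  exists j, (x j = 1 \/ x j = -1) /\ forall i, i != j -> x i = 0.
Proof.
move=> x1; have [j xj] : exists j, x j != 0.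
  apply/existsP; apply: contra_eqT x1; rewrite negb_exists => /forallP x0.
  by rewrite big1 // => i _; have := x0 i; rewrite negbK => /eqP ->.
have sq_ge1 i : x i != 0 -> 1 <= x i ^+ 2.
  by move=> xi; rewrite -gtz0_ge1 exprn_even_gt0.
have rest i : i != j -> x i = 0.
  move=> ij; apply/eqP; apply: contraT => xi.
  move: x1; rewrite (bigD1 j) //= (bigD1 i) //=.
  have := sq_ge1 _ xi; have := sq_ge1 _ xj.
  have : 0 <= \sum_(l | (l != j) && (l != i)) x l ^+ 2.
    by apply: sumr_ge0 => l _; exact: sqr_ge0.
  move: (x j ^+ 2) (x i ^+ 2) (\sum_(l | _) _) => a b c; lia.
exists j; split=> //; move: x1; rewrite (bigD1 j) //= big1 => [|i /rest ->];
  last first.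
  by rewrite expr0n.
rewrite addr0 => /eqP; rewrite -[1](expr1n _ 2) eqf_sqr => /orP[/eqP|/eqP];
  by [left|right].
Qed.

Lemma signed_perm_exists (P : sperm) : exists p s, signed_perm (val P) p s.
Proof.
have PPT i j : \sum_l val P i l * val P j l = (i == j)%:R.
  have /eqP/matrixP/(_ i j) := valP P; rewrite !mxE => <-.
  by apply: eq_bigr => l _; rewrite mxE.
have row1 i : exists j, (val P i j = 1 \/ val P i j = -1) /\
    forall l, l != j -> val P i l = 0.
  apply: (@sum_sqr_int_eq1 (fun l => val P i l)).
  transitivity ((i == i)%:R : int); last by rewrite eqxx.
  by rewrite -PPT; apply: eq_bigr => l _; rewrite expr2.
have [p pP] := choice row1.
have PE i j : val P i j = if j == p i then val P i (p i) else 0.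
  by case: eqP => [->//|/eqP]; exact: (pP i).2.
exists p, (fun i => val P i (p i)); split=> [i j pij|i|//];
  last exact: (pP i).1.
apply/eqP; have := PPT i j; rewrite (bigD1 (p i)) //= big1 => [|l lp];
  last first.
  by rewrite (pP i).2 ?mul0r.
rewrite addr0 pij; case: eqP => // _ /eqP.
have [+ _] := pP i; have [+ _] := pP j; rewrite pij.
by move=> [->|->] [->|->].
Qed.

Lemma signed_perm_mul (S : pzRingType) (P : 'M[int]_k) p s m (X : 'M[S]_(k,
  m)) i c :
  signed_perm P p s -> (map_mx intr P *m X) i c = (s i)%:~R * X (p i) c.
Proof.
case=> _ _ PE; rewrite mxE (bigD1 (p i)) //= big1 => [|j jp].
  by rewrite addr0 mxE PE eqxx.
by rewrite mxE PE (negPf jp) mul0r.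
Qed.

Lemma signed_perm_mulz (P : 'M[int]_k) p s m (X : 'M[int]_(k, m)) i c :
  signed_perm P p s -> (P *m X) i c = s i * X (p i) c.
Proof.
move=> Pps; have := @signed_perm_mul int P p s m X i c Pps.
by rewrite intz => <-; congr ((_ *m _) i c); apply/matrixP => a b;
  rewrite mxE intz.
Qed.

Lemma sperm_one_subproof : (1%:M : 'M[int]_k) *m 1%:M^T == 1%:M.
Proof. by rewrite trmx1 mulmx1. Qed.

Definition sperm_one : sperm := exist _ 1%:M sperm_one_subproof.

Lemma sperm_mul_subproof (P Q : sperm) :
  (val P *m val Q) *m (val P *m val Q)^T == 1%:M.
Proof.
by rewrite trmx_mul mulmxA -(mulmxA _ _ (val Q)^T) (eqP (valP Q)) mulmx1 (valP
  P).
Qed.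

Definition sperm_mul P Q : sperm :=
  exist (fun M : 'M[int]_k => M *m M^T == 1%:M) _ (sperm_mul_subproof P Q).

Lemma sperm_inv_subproof (P : sperm) : (val P)^T *m (val P)^T^T == 1%:M.
Proof. by rewrite trmxK sperm_VK. Qed.

Definition sperm_inv P : sperm :=
  exist (fun M : 'M[int]_k => M *m M^T == 1%:M) _ (sperm_inv_subproof P).

Variable n : nat.

Definition actD (P : sperm) (v : 'rV[int]_(k * n)) : 'rV[int]_(k * n) :=
  mxvec (val P *m vec_mx v).

Lemma actD1 v : actD sperm_one v = v.
Proof. by rewrite /actD mul1mx vec_mxK. Qed.

Lemma actDM P Q v : actD (sperm_mul P Q) v = actD P (actD Q v).
Proof. by rewrite /actD mxvecK mulmxA. Qed.

Lemma actDV P v : actD (sperm_inv P) (actD P v) = v.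
Proof. by rewrite /actD mxvecK mulmxA sperm_VK mul1mx vec_mxK. Qed.

Lemma actDB P u v : actD P (u - v) = actD P u - actD P v.
Proof. by rewrite /actD [vec_mx _]linearB mulmxBr [mxvec _]linearB. Qed.

Lemma sum_mxvec_index (V : nmodType) (f : 'I_(k * n) -> V) :
  \sum_l f l = \sum_i \sum_j f (mxvec_index i j).
Proof.
rewrite (reindex _ (curry_mxvec_bij k n)) pair_bigA /=.
by apply: eq_bigr => -[i j] _.
Qed.

(** The rank of a vertex: the dimension of the face of which it is the barycentre. *)
Definition n_odd (v : 'rV[int]_(k * n)) : nat :=
  (\sum_(l < k * n) odd `|v 0%R l|)%N.

Lemma n_odd_actD P v : n_odd (actD P v) = n_odd v.
Proof.
rewrite /n_odd !sum_mxvec_index.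
have [p [s Pps]] := signed_perm_exists P; have [pinj s1 _] := Pps.
rewrite [RHS](reindex_inj pinj) /=; apply: eq_bigr => i _;
  apply: eq_bigr => j _.
rewrite /actD mxvecE (signed_perm_mulz _ _ _ Pps) mxE.
by case: (s1 i) => ->; rewrite ?mul1r ?mulN1r ?abszN.
Qed.

End SignedPermutations.

Lemma card_lt_inj d (r : 'I_d -> 'I_d) i : injective r -> (i <= d)%N ->
  #|[pred l | (r l < i)%N]| = i.
Proof.
move=> rinj id; rewrite -sum1_card -(@reindex_inj _ _ _ _ r (fun l =>
  (l < i)%N) (fun=> 1%N)) //=.
rewrite -(big_ord_widen_cond _ xpredT (fun=> 1%N)) // sum1_card card_ord //.
Qed.

Lemma n_odd_vert k n L (s : flag (k * n) L) (i : 'I_(k * n).+1) :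
  n_odd (vert s i) = i.
Proof.
have id : (i <= k * n)%N by rewrite -ltnS.
rewrite /n_odd -[RHS](card_lt_inj (@perm_inj _ s.2) id).
rewrite -sum1_card [RHS]big_mkcond /=; apply: eq_bigr => l _; rewrite mxE.
rewrite inE; case: (_ < _)%N; case: (s.1.2 l); rewrite ?expr0 ?expr1 /=; lia.
Qed.

(** * The space of equations *)

Lemma mx_norm_le (R : realType) m n (A : 'M[R]_(m, n)) (e : R) : 0 <= e ->
  (forall i j, `|A i j| <= e) -> `|A| <= e.
Proof.
by move=> e0 Ae; rewrite /Num.norm /= mx_normrE;
  apply: bigmax_le => // -[i j] _.
Qed.

Lemma le_mx_norm (R : realType) m n (A : 'M[R]_(m, n)) i j : `|A i j| <= `|A|.
Proof.
rewrite [leRHS]/Num.norm /= mx_normrE.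
by apply: le_trans (le_bigmax _ _ (i, j)).
Qed.

Section TargetSpace.
Variables (R : realType) (k r : nat).
Local Notation W := ('M[R]_k * 'M[R]_k * 'M[R]_(k, r))%type.
Implicit Types (P : sperm k) (w : W) (z : 'M[R]_(k, k + r)).

Definition sR P : 'M[R]_k := map_mx intr (val P).

Lemma sR_VK P : (sR P)^T *m sR P = 1%:M.
Proof. by rewrite /sR map_trmx -map_mxM sperm_VK map_mx1. Qed.

Lemma sR_KV P : sR P *m (sR P)^T = 1%:M.
Proof. by rewrite /sR map_trmx -map_mxM (eqP (valP P)) map_mx1. Qed.

Lemma sR_mul P Q : sR (sperm_mul P Q) = sR P *m sR Q.
Proof. by rewrite /sR map_mxM. Qed.

Lemma sR_inv P : sR (sperm_inv P) = (sR P)^T.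
Proof. by rewrite /sR map_trmx. Qed.

Lemma sR_mulE P p s m (X : 'M[R]_(k, m)) i c : signed_perm (val P) p s ->
  (sR P *m X) i c = (s i)%:~R * X (p i) c.
Proof. exact: signed_perm_mul. Qed.

Lemma sR_conjE P p s (A : 'M[R]_k) i j : signed_perm (val P) p s ->
  (sR P *m A *m (sR P)^T) i j = (s i)%:~R * (s j)%:~R * A (p i) (p j).
Proof.
move=> Pps; rewrite -mulmxA (sR_mulE _ _ _ Pps) -mulrA; congr (_ * _).
have -> : A *m (sR P)^T = (sR P *m A^T)^T by rewrite trmx_mul trmxK.
by rewrite mxE (sR_mulE _ _ _ Pps) mxE.
Qed.

Lemma signed_perm_norm (p : 'I_k -> 'I_k) (s : 'I_k -> int) (M : 'M[int]_k) i :
  signed_perm M p s -> `|(s i)%:~R : R| = 1.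
Proof. by case=> _ s1 _; case: (s1 i) => ->;
  rewrite ?normr1 ?normrN1 // mulrNz normrN normr1. Qed.

Definition offdiag (A : 'M[R]_k) : 'M[R]_k :=
  \matrix_(i, j) if i == j then 0 else A i j.

Lemma offdiag_conj P (A : 'M[R]_k) :
  sR P *m offdiag A *m (sR P)^T = offdiag (sR P *m A *m (sR P)^T).
Proof.
have [p [s Pps]] := signed_perm_exists P; have [pinj _ _] := Pps.
apply/matrixP => i j; rewrite (sR_conjE _ _ _ Pps) [RHS]mxE [offdiag A _ _]mxE.
by rewrite (inj_eq pinj) (sR_conjE _ _ _ Pps); case: eqP; rewrite ?mulr0.
Qed.

(** The effect on the three blocks of equations of replacing [X] by [sR P *m X]. *)
Definition actT_fun P w : W :=
  (sR P *m w.1.1 *m (sR P)^T, sR P *m w.1.2 *m (sR P)^T, sR P *m w.2).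

Lemma actT_fun_linear P : linear (actT_fun P).
Proof.
move=> a u v; rewrite /actT_fun /=.
by rewrite !(mulmxDr, mulmxDl) -!(scalemxAr, scalemxAl).
Qed.

HB.instance Definition _ P :=
  GRing.isLinear.Build R W W _ _ (actT_fun_linear P).

Definition actT P : 'End(W) := linfun (actT_fun P).

Lemma actTE P w : actT P w = actT_fun P w.
Proof. by rewrite lfunE. Qed.

Lemma actTM P Q w : actT (sperm_mul P Q) w = actT P (actT Q w).
Proof.
by rewrite !actTE /actT_fun /= !sR_mul !trmx_mul !mulmxA.
Qed.

Lemma actT_invK P w : actT (sperm_inv P) (actT P w) = w.
Proof.
rewrite !actTE /actT_fun /= !sR_inv !trmxK !mulmxA sR_VK !mul1mx.
by rewrite -!mulmxA sR_VK !mulmx1; case: w => -[].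
Qed.

Lemma actT_Kinv P w : actT P (actT (sperm_inv P) w) = w.
Proof.
rewrite !actTE /actT_fun /= !sR_inv !trmxK !mulmxA sR_KV !mul1mx.
by rewrite -!mulmxA sR_KV !mulmx1; case: w => -[].
Qed.

Lemma actT_inj P : lker (actT P) == 0%VS.
Proof. by apply/lker0P => u v e; rewrite -(actT_invK P u) e actT_invK. Qed.

Lemma target_norm_le w (e : R) : 0 <= e ->
    (forall i j, `|w.1.1 i j| <= e) -> (forall i j, `|w.1.2 i j| <= e) ->
    (forall i j, `|w.2 i j| <= e) ->
  `|w| <= e.
Proof.
move=> e0 h1 h2 h3.
have -> : `|w| = Num.max (Num.max `|w.1.1| `|w.1.2|) `|w.2| by [].
by rewrite !ge_max !mx_norm_le.
Qed.

Lemma le_target_norm w : [/\ forall i j, `|w.1.1 i j| <= `|w|,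
  forall i j, `|w.1.2 i j| <= `|w| & forall i j, `|w.2 i j| <= `|w|].
Proof.
have -> : `|w| = Num.max (Num.max `|w.1.1| `|w.1.2|) `|w.2| by [].
by split=> i j; rewrite !le_max le_mx_norm ?orbT.
Qed.

Lemma actT_le P w : `|actT P w| <= `|w|.
Proof.
have [p [s Pps]] := signed_perm_exists P; have [w1 w2 w3] := le_target_norm w.
have s1 i := signed_perm_norm i Pps.
rewrite actTE; apply: target_norm_le => //= i j.
- by rewrite (sR_conjE _ _ _ Pps) !normrM !s1 !mul1r.
- by rewrite (sR_conjE _ _ _ Pps) !normrM !s1 !mul1r.
- by rewrite (sR_mulE _ _ _ Pps) !normrM !s1 !mul1r.
Qed.

(* The derivative at [row_mx 1 0] of
   [X |-> (X X^T, offdiag (X_l D X_l^T), X_r)] with [D = diag(0, .., k-1)]. *)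
Definition lin_fun z : W :=
  (\matrix_(i, j) (z i (lshift r j) + z j (lshift r i)),
   \matrix_(i, j) (if i == j then 0 else
      i%:R * z j (lshift r i) + j%:R * z i (lshift r j)),
   rsubmx z).

(** For [i != j] this solves [z_ij + z_ji = S_ij] together with [i z_ji + j z_ij = T_ij]; the
    determinant [j - i] is nonzero because the diagonal entries of [D] are distinct. *)
Definition lin_inv w : 'M[R]_(k, k + r) :=
  row_mx (\matrix_(i, j) (if i == j then w.1.1 i j / 2 else
            (w.1.2 i j - i%:R * w.1.1 i j) / (j%:R - i%:R))) w.2.

Lemma lin_fun_linear : linear lin_fun.
Proof.
move=> a u v; rewrite /lin_fun /=; congr (_, _, _).
- by apply/matrixP => i j; rewrite !mxE; ring.
- by apply/matrixP => i j; rewrite !mxE; case: eqP => _; ring.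
- by rewrite linearP.
Qed.

HB.instance Definition _ := GRing.isLinear.Build R _ W _ _ lin_fun_linear.

Lemma lin_fun_sum (I : finType) (c : I -> R) (z : I -> 'M[R]_(k, k + r)) :
  lin_fun (\sum_i c i *: z i) = \sum_i c i *: lin_fun (z i).
Proof.
apply: (big_rec2 (fun u w => lin_fun u = w)) => [|i w u _ <-].
  exact: linear0.
by rewrite lin_fun_linear.
Qed.

Lemma lin_inv_linear : linear lin_inv.
Proof.
move=> a u v; rewrite /lin_inv /= scale_row_mx add_row_mx; congr row_mx.
by apply/matrixP => i j; rewrite !mxE; case: eqP => _; ring.
Qed.

HB.instance Definition _ := GRing.isLinear.Build R W _ _ _ lin_inv_linear.

Lemma ord_subr_neq0 (i j : 'I_k) : i != j -> (j%:R - i%:R : R) != 0.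
Proof. by move=> ij; rewrite subr_eq0 eqr_nat eq_sym val_eqE. Qed.

Lemma lin_funK : cancel lin_fun lin_inv.
Proof.
move=> z; rewrite /lin_inv /= -[RHS]hsubmxK; congr row_mx.
apply/matrixP => i j; rewrite !mxE; case: (eqVneq i j) => [->|ij].
  by field.
by have := ord_subr_neq0 ij => ?; field.
Qed.

Definition target_sym w := [/\ w.1.1^T = w.1.1, w.1.2^T = w.1.2 &
  forall i, w.1.2 i i = 0].

Lemma lin_invK w : target_sym w -> lin_fun (lin_inv w) = w.
Proof.
case: w => -[S T] H [/= symS symT T0].
rewrite /lin_fun; congr (_, _, _); last by rewrite row_mxKr.
  apply/matrixP => i j; rewrite mxE !row_mxEl !mxE /= [j == i]eq_sym.
  case: (eqVneq i j) => [->|ij]; first by field.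
  have -> : S j i = S i j by rewrite -[in LHS]symS mxE.
  have -> : T j i = T i j by rewrite -[in LHS]symT mxE.
  have ij' := ord_subr_neq0 ij; have ji' : (i%:R - j%:R : R) != 0.
    by rewrite -opprB oppr_eq0.
  by field; apply/andP.
apply/matrixP => i j; rewrite mxE !row_mxEl !mxE /= [j == i]eq_sym.
case: (eqVneq i j) => [->|ij]; first by rewrite T0.
have -> : S j i = S i j by rewrite -[in LHS]symS mxE.
have -> : T j i = T i j by rewrite -[in LHS]symT mxE.
have ij' := ord_subr_neq0 ij; have ji' : (i%:R - j%:R : R) != 0.
  by rewrite -opprB oppr_eq0.
by field; apply/andP.
Qed.

(** Taken as an image so that its dimension follows from the injectivity of [lin_fun]. It has
    [k(k+1)/2 + k(k-1)/2 + kr] parameters. *)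
Definition targetU : {vspace W} := limg (linfun lin_fun).

Lemma lin_fun_sym z : target_sym (lin_fun z).
Proof.
split=> [||i] /=; last by rewrite mxE eqxx.
  by apply/matrixP => i j; rewrite !mxE addrC.
by apply/matrixP => i j; rewrite !mxE eq_sym; case: eqP => _ //; rewrite addrC.
Qed.

Lemma targetUP w : reflect (target_sym w) (w \in targetU).
Proof.
apply: (iffP memv_imgP) => [[z _ ->]|ws].
  by rewrite lfunE; exact: lin_fun_sym.
by exists (lin_inv w); rewrite ?memvf // lfunE /= lin_invK.
Qed.

Lemma lin_fun_in z : lin_fun z \in targetU.
Proof. by apply/targetUP/lin_fun_sym. Qed.

Lemma dim_targetU : \dim targetU = (k * (k + r))%N.
Proof.
rewrite limg_dim_eq.
  by rewrite dimvf /dim /=.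
apply/eqP; rewrite -subv0; apply/subvP => z; rewrite memv_cap => /andP[_].
by rewrite memv_ker lfunE memv0 /= => /eqP /(congr1 lin_inv);
  rewrite lin_funK linear0 => ->.
Qed.

Lemma actT_in P w : w \in targetU -> actT P w \in targetU.
Proof.
move=> /targetUP[symS symT T0]; apply/targetUP; rewrite actTE; split=> [||i] /=.
- by rewrite !trmx_mul trmxK symS mulmxA.
- by rewrite !trmx_mul trmxK symT mulmxA.
have [p [s Pps]] := signed_perm_exists P.
by rewrite (sR_conjE _ _ _ Pps) T0 mulr0.
Qed.

Lemma lin_inv_le w i c : `|lin_inv w i c| <= k.+1%:R * `|w|.
Proof.
have [w1 w2 w3] := le_target_norm w.
have le1 x : x <= `|w| -> x <= k.+1%:R * `|w|.
  by move=> xw; apply: le_trans xw _; rewrite ler_peMl // ler1n.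
rewrite /lin_inv; case: (split_ordP c) => j ->; last by rewrite row_mxEr le1.
rewrite row_mxEl mxE; case: (eqVneq i j) => [->|ij].
  apply: le1; apply: le_trans (w1 j j); rewrite normrM ler_piMr //.
  by rewrite ger0_norm ?invr_ge0 // invf_le1 // ler1n.
have ge1 : 1 <= `|j%:R - i%:R : R|.
  have [ij'|ji'|/val_inj ij'] := ltngtP i j; last by rewrite ij' eqxx in ij.
    by rewrite ger0_norm -?natrB ?ler1n ?subn_gt0 // ?ler0n // ltnW.
  by rewrite distrC ger0_norm -?natrB ?ler1n ?subn_gt0 // ?ler0n // ltnW.
rewrite normrM normfV ler_pdivrMr; last exact: lt_le_trans ltr01 ge1.
apply: (@le_trans _ _ (k.+1%:R * `|w|)); last first.
  by rewrite ler_peMr // mulr_ge0.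
rewrite (le_trans (ler_normB _ _)) // -natr1 mulrDl mul1r addrC lerD // normrM.
by rewrite ler_pM // normr_nat ler_nat ltnW.
Qed.

(** Both systems have this shape with the same first block, so one Gram entry can separate both from
    0 at once. *)
Definition frame_map m (X : 'M[R]_(k, m)) (A : 'M[R]_k) (H : 'M[R]_(k,
  r)) : W :=
  (X *m X^T - 1%:M, offdiag A, H).

Lemma actT_frame_map P m (X : 'M[R]_(k, m)) A H :
  actT P (frame_map X A H) =
  frame_map (sR P *m X) (sR P *m A *m (sR P)^T) (sR P *m H).
Proof.
rewrite actTE /actT_fun /frame_map /= offdiag_conj; congr (_, _, _).
by rewrite mulmxBr mulmxBl mulmx1 sR_KV trmx_mul !mulmxA.
Qed.

Lemma frame_map_in m (X : 'M[R]_(k, m)) A H : A^T = A ->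
  frame_map X A H \in targetU.
Proof.
move=> symA; apply/targetUP; split=> [||i] /=.
- by rewrite linearB /= trmx_mul trmxK trmx1.
- by apply/matrixP => i j; rewrite !mxE -[in A j i]symA mxE eq_sym.
- by rewrite mxE eqxx.
Qed.

End TargetSpace.

(** * Locating a zero flag *)

Section FlagLocation.
Variables (R : realFieldType) (d : nat).

(** Alcoves of the whole lattice, without the box, so that signed permutations preserve the
    notion. *)
Definition flaglike (p : nat -> 'rV[int]_d) : Prop :=
  exists (a s : 'I_d -> int) (r : 'I_d -> 'I_d),
    [/\ injective r, forall l, s l = 1 \/ s l = -1 &
        forall i l, p i 0 l = a l *+ 2 + s l * (r l < i)%:R].

Lemma flaglike_vert L (s : flag d L) : flaglike (vert s).
Proof.
exists (fun l => (s.1.1 l)%:Z - L%:Z), (fun l => (-1) ^+ s.1.2 l), s.2.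
split=> [||i l]; [exact: perm_inj| |by rewrite mxE].
by move=> l; case: (s.1.2 l); rewrite ?expr0 ?expr1; [right|left].
Qed.

(** An interior point determines its alcove. The tail sum [A (r l)] of barycentric coordinates is
    the displacement of coordinate [l] from its even entry; it lies strictly between 0 and 1 and
    decreases with the rank, so the order of the [t l] recovers [r]. *)
Lemma flaglike_eq (p : nat -> 'rV[int]_d) (c : 'I_d.+1 -> R)
    (b : 'I_d -> int) (t : 'I_d -> R) :
    flaglike p -> (forall i, 0 < c i) -> \sum_i c i = 1 ->
    (forall l, \sum_(i < d.+1) c i * (p i 0 l)%:~R = (b l *+ 2)%:~R + t l) ->
    (forall l, 0 < t l < 1) -> (forall l m : 'I_d, (l < m)%N -> t m < t l) ->
  forall i l, p i 0 l = b l *+ 2 + (l < i)%:R.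
Proof.
case=> a [s [r [rinj s1 pE]]] c_gt0 c1 pt t01 t_decr.
pose A (q : nat) := \sum_(i < d.+1) c i * (q < i)%:R.
have A_decr q q' : (q <= q')%N -> A q' <= A q.
  move=> qq'; apply: ler_sum => i _; apply: ler_wpM2l; rewrite ?ler_nat;
    first exact: ltW.
  by have [q'i|//] := boolP (q' < i)%N; rewrite (leq_ltn_trans qq').
have A_gt0 q : (q < d)%N -> 0 < A q.
  move=> qd; rewrite /A (bigD1 ord_max) //= qd mulr1 ltr_pwDl //.
  by apply: sumr_ge0 => i _; rewrite mulr_ge0 // ltW.
have A_lt1 q : A q < 1.
  rewrite /A (bigD1 ord0) //= mulr0 add0r -[ltRHS]c1 [ltRHS](bigD1 ord0) //=.
  rewrite ltr_pwDl //; apply: ler_sum => i _.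
  by apply: ler_piMr; rewrite ?lern1 ?leq_b1 ?ltW.
have key l : a l = b l /\ s l = 1 /\ A (r l) = t l.
  have E : (a l *+ 2)%:~R + (s l)%:~R * A (r l) = (b l *+ 2)%:~R + t l.
    rewrite -pt; under [RHS]eq_bigr do rewrite pE rmorphD rmorphM /= mulrDr.
    rewrite big_split /= -mulr_suml c1 mul1r mulr_sumr; congr (_ + _).
    by apply: eq_bigr => i _; rewrite mulrCA; congr (_ * (_ * _));
      case: (_ < _)%N.
  have Aq0 := A_gt0 _ (ltn_ord (r l)); have Aq1 := A_lt1 (r l).
  have /andP[t0 t1] := t01 l.
  have DE : (a l - b l)%:~R *+ 2 = t l - (s l)%:~R * A (r l).
    by move: E; rewrite rmorphB /= !rmorphMn /= !mulr2n; lra.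
  (* A positive sign gives [|a - b| < 1], hence equality; a negative one gives [0 < a - b < 1],
     impossible for integers. *)
  case: (s1 l) DE E => ->; rewrite ?mulrN1z ?mul1r ?mulN1r => DE E.
    have ab : a l = b l.
      have h1 : (a l - b l)%:~R < 1 :> R by move: DE; rewrite mulr2n; lra.
      have h2 : -1 < (a l - b l)%:~R :> R by move: DE; rewrite mulr2n; lra.
      move: h1 h2; rewrite -[1]/(1%:~R) -mulrNz !ltr_int; lia.
    by split=> //; split=> //; move: E; rewrite ab; lra.
  have h1 : (a l - b l)%:~R < 1 :> R by move: DE; rewrite mulr2n; lra.
  have h2 : 0 < (a l - b l)%:~R :> R by move: DE; rewrite mulr2n; lra.
  by move: h1 h2; rewrite -[1]/(1%:~R) ltr_int ltr0z; lia.
have r_mono (l m : 'I_d) : (l < m)%N -> (r l < r m)%N.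
  move=> lm; rewrite ltnNge; apply/negP => /A_decr.
  have [_ [_ ->]] := key l; have [_ [_ ->]] := key m.
  by rewrite leNgt t_decr.
have rE (l : 'I_d) : r l = l :> nat.
  rewrite -(@card_lt_inj d r (r l) rinj (ltnW (ltn_ord _))).
  rewrite -[RHS](@card_lt_inj d id l (fun _ _ => id) (ltnW (ltn_ord _))).
  apply: eq_card => m; rewrite !inE; apply/idP/idP; last exact: r_mono.
  by apply: contraTT; rewrite -!leqNgt leq_eqVlt =>
    /predU1P[/val_inj ->//|/r_mono/ltnW].
move=> i l; rewrite pE; have [-> [-> _]] := key l; by rewrite mul1r rE.
Qed.

(* The partial tails of the coefficients are determined up to a small relative
   error by their total, so consecutive differences all have its sign. *)
Lemma barycentric_sign (c : 'I_d.+1 -> R) (w : 'I_d.+1 -> 'I_d -> R) :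
    (exists i, c i != 0) ->
    (forall i l, `|w i l| <= 8%:R^-1 / d.+1%:R) ->
    (forall l : 'I_d, \sum_i c i *
      ((l < i)%:R - (1 - l.+1%:R / d.+1%:R) + w i l) = 0) ->
  (forall i, 0 < c i) \/ (forall i, c i < 0).
Proof.
move=> [i0 ci0] w_small dep.
pose S := \sum_i c i; pose La := \sum_i `|c i|.
have La_gt0 : 0 < La.
  rewrite /La (bigD1 i0) //= ltr_pwDl ?normr_gt0 //.
  by apply: sumr_ge0.
have D_gt0 : 0 < d.+1%:R :> R by rewrite ltr0n.
(* Each [c i] will be within [2 ka La] of [S / d.+1]; since [2 ka d.+1 = 1/4], the [d.+1] errors
   together stay below a quarter of [La]. *)
set ka := 8%:R^-1 / d.+1%:R in w_small.
have ka_gt0 : 0 < ka by rewrite /ka divr_gt0 // invr_gt0.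
have kaD : ka * d.+1%:R = 8%:R^-1 by rewrite /ka divfK // gt_eqF.
clearbody ka.
pose B (j : nat) := \sum_(i < d.+1) c i * (j <= i)%:R.
have B_approx j : (j <= d.+1)%N -> `|B j - (1 - j%:R / d.+1%:R) * S| <= ka * La.
  case: j => [_|j].
    have -> : B 0 = S by apply: eq_bigr => i _; rewrite mulr1.
    by rewrite mul0r subr0 mul1r subrr normr0 mulr_ge0 // ltW.
  rewrite ltnS leq_eqVlt => /predU1P[->|jd].
    rewrite /B big1 => [|i _]; last by rewrite leqNgt ltn_ord mulr0.
    by rewrite divff ?gt_eqF // subrr mul0r subrr normr0 mulr_ge0 // ltW.
  have := dep (Ordinal jd); under eq_bigr do rewrite /= mulrDr mulrBr.
  rewrite big_split sumrB /= -mulr_suml -/S => E.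
  have -> : B j.+1 - (1 - j.+1%:R / d.+1%:R) * S =
      - \sum_i c i * w i (Ordinal jd).
    rewrite /B; move: E; rewrite [S * _]mulrC;
      move: (_ * S) (\sum_(i < _) c i * w i _) (\sum_(i < _) _) => x y z; lra.
  rewrite normrN (le_trans (ler_norm_sum _ _ _)) // /La mulr_sumr.
  by apply: ler_sum => i _; rewrite normrM mulrC ler_wpM2r.
have cE (i : 'I_d.+1) : c i = B i - B i.+1.
  rewrite /B -sumrB (bigD1 i) //= leqnn ltnn mulr0 mulr1 subr0.
  rewrite big1 ?addr0 // => j ji; rewrite -mulrBr leq_eqVlt.
  by rewrite eq_sym val_eqE (negPf ji) subrr mulr0.
have c_approx i : `|c i - S / d.+1%:R| <= ka * La *+ 2.
  have := B_approx i (ltnW (ltn_ord i)); have := B_approx i.+1 (ltn_ord i).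
  rewrite !ler_norml cE -[i.+1%:R]natr1 => /andP[h1 h2] /andP[h3 h4].
  have E : (1 - (i%:R + 1) / d.+1%:R) * S =
    (1 - i%:R / d.+1%:R) * S - S / d.+1%:R by ring.
  rewrite E in h1 h2; rewrite mulr2n; move: h1 h2 h3 h4.
  move: (ka * La) (S / _) ((1 - _) * S) (B i) (B i.+1) => x1 x2 x3 x4 x5 *.
  by apply/andP; split; lra.
have LaS : La <= 2 * `|S|.
  have : La <= `|S| + 4%:R^-1 * La.
    have -> : `|S| + 4%:R^-1 * La =
        \sum_(i < d.+1) (`|S| / d.+1%:R + ka * La *+ 2).
      rewrite sumr_const card_ord -[_ *+ d.+1]mulr_natr mulrDl divfK ?gt_eqF //.
      rewrite mulrnAl mulrAC kaD mulr2n; lra.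
    apply: ler_sum => i _; rewrite -[c i](subrK (S / d.+1%:R)) addrC.
    rewrite (le_trans (ler_normD _ _)) // lerD ?c_approx //.
    by rewrite normrM normfV (gtr0_norm D_gt0).
  lra.
have err : ka * La *+ 2 < `|S| / d.+1%:R.
  rewrite ltr_pdivlMr // mulrnAl mulrAC kaD mulr2n.
  have : 0 < `|S| by move: LaS La_gt0; lra.
  lra.
have [S0|S0] := lerP 0 S; [left|right] => i.
  have := c_approx i; rewrite ler_norml => /andP[h _].
  by move: err h; rewrite (ger0_norm S0); move: (S / _) (_ *+ 2) => x y; lra.
have := c_approx i; rewrite ler_norml => /andP[_ h].
by move: err h; rewrite (ltr0_norm S0) mulNr; move: (S / _) (_ *+ 2) => x y;
  lra.
Qed.

End FlagLocation.

Lemma flaglike_actD k n (P : sperm k) (p : nat -> 'rV[int]_(k * n)) :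
  flaglike p -> flaglike (fun i => actD P (p i)).
Proof.
case=> a [s [r [rinj s1 pE]]].
have [q [e Pqe]] := signed_perm_exists P; have [qinj e1 _] := Pqe.
have [g gK fK] := curry_mxvec_bij k n.
pose tau (l : 'I_(k * n)) := mxvec_index (q (g l).1) (g l).2.
exists (fun l => e (g l).1 * a (tau l)), (fun l => e (g l).1 * s (tau l)),
  (fun l => r (tau l)).
split=> [l m /rinj|l|i l].
- rewrite /tau => e2; rewrite -(fK l) // -(fK m) //.
  have := congr1 g e2; rewrite -[mxvec_index _ _]/(uncurry (@mxvec_index k n)
    (_, _)) gK //.
  rewrite -[mxvec_index _ _]/(uncurry (@mxvec_index k n) (_,
    _)) gK // => -[/qinj].
  by case: (g l) (g m) => ? ? [? ?] /= -> ->.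
- by case: (e1 (g l).1) => ->; case: (s1 (tau l)) => ->;
    rewrite ?mul1r ?mulN1r ?opprK; [left|right|right|left].
rewrite /tau; case/mxvec_indexP: l => i0 j0.
have -> : g (mxvec_index i0 j0) = (i0, j0) by exact: gK (i0, j0) isT.
rewrite /actD mxvecE (signed_perm_mulz _ _ _ Pqe) mxE pE /=.
by rewrite mulrDr mulrA; congr (_ + _); rewrite mulrnAr.
Qed.

(** * The diagonal quadratic map *)

Section GridMaps.
Variables (R : realType) (k r M : nat).
Hypothesis M_gt0 : (0 < M)%N.
Local Notation n := (k + r)%N.
Local Notation d := (k * (k + r))%N.
Local Notation W := ('M[R]_k * 'M[R]_k * 'M[R]_(k, r))%type.
Implicit Types (g : sperm k) (v : 'rV[int]_(k * (k + r))).

(** The even denominator makes every signed coordinate frame a grid vertex with even entries. *)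
Definition mesh : R := (M.*2%:R)^-1.

Lemma mesh_gt0 : 0 < mesh.
Proof. by rewrite invr_gt0 ltr0n double_gt0. Qed.

Lemma meshM (x : int) : mesh * (x * M.*2)%:~R = x%:~R.
Proof.
by rewrite intrM mulrCA mulVf ?mulr1 // pnatr_eq0 -lt0n double_gt0.
Qed.

Definition rX v : 'M[R]_(k, n) := mesh *: map_mx intr (vec_mx v).

Lemma rX_actD g v : rX (actD g v) = sR R g *m rX v.
Proof. by rewrite /rX /actD mxvecK map_mxM scalemxAr. Qed.

Lemma rXE v i j : rX v i j = mesh * (v 0 (mxvec_index i j))%:~R.
Proof. by rewrite !mxE. Qed.

Definition frame0 : 'M[R]_(k, n) := row_mx 1%:M 0.

Definition close_at (e : R) g v : Prop :=
  forall i j, `|(sR R g *m rX v - frame0) i j| < e.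

Lemma sR_norm_le m (X : 'M[R]_(k, m)) g e :
  (forall i j, `|X i j| < e) -> forall i j, `|(sR R g *m X) i j| < e.
Proof.
move=> Xe i j; have [p [s Pps]] := signed_perm_exists g.
by rewrite (sR_mulE _ _ _ Pps) normrM (signed_perm_norm _ _ Pps) mul1r.
Qed.

(** The integral matrices [(val g)^T] and [(val h)^T] both approximate the left block of [rX v], so
    their entries differ by less than 1. *)
Lemma close_at_uniq (a b : R) g h v : a + b <= 1 -> close_at a g v ->
  close_at b h v -> g = h.
Proof.
move=> ab1 ga hb; apply/val_inj/trmx_inj/matrixP => i j.
have E q : rX v - (sR R q)^T *m frame0 =
    sR R (sperm_inv q) *m (sR R q *m rX v - frame0).
  by rewrite sR_inv mulmxBr mulmxA sR_VK mul1mx.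
have Xq c q : close_at c q v ->
    `|rX v i (lshift r j) - ((val q)^T i j)%:~R| < c.
  move=> /(@sR_norm_le _ _ (sperm_inv q))/(_ i (lshift r j)).
  rewrite -E mxE [X in _ + X]mxE /frame0 mul_mx_row mulmx1 row_mxEl.
  by rewrite /sR !mxE.
have : `|((val g)^T i j - (val h)^T i j)%:~R : R| < 1.
  apply: lt_le_trans ab1; rewrite rmorphB /=.
  rewrite (_ : _ - _ = (rX v i (lshift r j) - ((val h)^T i j)%:~R) -
    (rX v i (lshift r j) - ((val g)^T i j)%:~R)); last by ring.
  by rewrite (le_lt_trans (ler_normB _ _)) // addrC ltrD ?Xq.
rewrite -intr_norm -[1]/(1%:~R) ltr_int => lt1.
by apply/eqP; rewrite -subr_eq0 -normr_le0; lia.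
Qed.

Definition diagD : 'M[R]_k := diag_mx (\row_i i%:R).

Definition quad (X : 'M[R]_(k, n)) : W :=
  frame_map X (lsubmx X *m diagD *m (lsubmx X)^T) (rsubmx X).

Lemma lsubmx_mul g (X : 'M[R]_(k, n)) :
  (lsubmx (sR R g *m X) = sR R g *m lsubmx X) *
  (rsubmx (sR R g *m X) = sR R g *m rsubmx X).
Proof.
by rewrite -{1 3}[X]hsubmxK mul_mx_row row_mxKl row_mxKr.
Qed.

Lemma quad_sR g X : quad (sR R g *m X) = actT R r g (quad X).
Proof. by rewrite /quad actT_frame_map !lsubmx_mul trmx_mul !mulmxA. Qed.

Lemma quad_in X : quad X \in targetU R k r.
Proof. by apply: frame_map_in; rewrite !trmx_mul trmxK tr_diag_mx mulmxA. Qed.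

(** The quadratic part of [quad]; the expansion at [frame0] stops there, and the last block is
    already linear. *)
Definition quad_rest (z : 'M[R]_(k, n)) : W :=
  (z *m z^T, offdiag (lsubmx z *m diagD *m (lsubmx z)^T), 0).

Lemma quad_frame0D z : quad (frame0 + z) = lin_fun z + quad_rest z.
Proof.
rewrite /quad /frame_map /lin_fun /quad_rest /frame0.
rewrite (_ : row_mx 1%:M 0 + z = row_mx (1%:M + lsubmx z) (rsubmx z));
  last first.
  by rewrite -{1}[z]hsubmxK add_row_mx add0r.
rewrite row_mxKl row_mxKr -[in z *m z^T](hsubmxK z); congr (_, _, _);
  last 1 first.
- by rewrite addr0.
- rewrite !tr_row_mx !mul_row_col linearD /= trmx1 mulmxDl mul1mx.
  rewrite mulmxDr mulmx1.
  move: (lsubmx z *m _) (rsubmx z *m _) => u w.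
  by apply/matrixP => i j; rewrite !mxE; ring.
rewrite linearD /= trmx1 !mulmxDl !mulmxDr !mulmx1 mul1mx.
move: (lsubmx z *m diagD *m _) => u.
apply/matrixP => i j; rewrite mxE [RHS]mxE /= [in RHS]mxE [offdiag u i j]mxE.
case: eqVneq => ij; first by rewrite addr0.
by rewrite !mul_diag_mx !mul_mx_diag !mxE (negPf ij) mulr0n; ring.
Qed.

Lemma diagD_entry (A : 'M[R]_k) i j :
  (A *m diagD *m A^T) i j = \sum_l A i l * l%:R * A j l.
Proof.
rewrite mxE; apply: eq_bigr => l _; rewrite mul_mx_diag !mxE; ring.
Qed.

Lemma quad_rest_le (z : 'M[R]_(k, n)) (e : R) : (0 < k)%N ->
  (forall i j, `|z i j| <= e) ->
  `|quad_rest z| <= d%:R * e ^+ 2.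
Proof.
move=> k_gt0 ze; have e_ge0 : 0 <= e.
  by apply: le_trans (ze (Ordinal k_gt0) (lshift r (Ordinal k_gt0))).
have dn : (n <= d)%N by rewrite leq_pmull.
have dk : (k * k <= d)%N by rewrite leq_mul2l leq_addr orbT.
have C0 : 0 <= d%:R * e ^+ 2 by rewrite mulr_ge0 ?sqr_ge0.
apply: target_norm_le => //= i j; last by rewrite mxE normr0.
- rewrite mxE (le_trans (ler_norm_sum _ _ _)) //.
  apply: (@le_trans _ _ (\sum_(l < n) e ^+ 2)).
    by apply: ler_sum => l _; rewrite mxE normrM expr2 ler_pM.
  rewrite sumr_const card_ord -[_ *+ n]mulr_natl ler_wpM2r ?sqr_ge0 //.
  by rewrite ler_nat.
rewrite mxE; case: eqP => _; first by rewrite normr0.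
rewrite diagD_entry (le_trans (ler_norm_sum _ _ _)) //.
apply: (@le_trans _ _ (\sum_(l < k) k%:R * e ^+ 2)).
  apply: ler_sum => l _; rewrite !normrM [leRHS](_ : _ = e * k%:R * e);
    last by ring.
  rewrite !mxE ler_pM ?mulr_ge0 ?ler_pM //.
  by rewrite normr_nat ler_nat ltnW.
rewrite sumr_const card_ord -[_ *+ k]mulr_natl mulrA ler_wpM2r ?sqr_ge0 //.
by rewrite -natrM ler_nat.
Qed.

End GridMaps.

(** * Vertices with trivial stabilizer *)

Section GoodVertices.
Variables (k n B : nat).
Implicit Types (g : sperm k) (v : 'rV[int]_(k * n)).

(* Outside the boundary of the box, and with trivial stabilizer. *)
Definition good v : Prop :=
  [/\ forall l, (`|v 0 l| < B%:Z)%R,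
      forall i, exists j, vec_mx v i j != 0 &
      forall i j (e : bool), i != j ->
        exists c, vec_mx v i c != (-1) ^+ e * vec_mx v j c].

Lemma good_actD g v : good v -> good (actD g v).
Proof.
case=> vB v0 vN; have [p [s gps]] := signed_perm_exists g.
have [pinj s1 _] := gps.
have aE i j : vec_mx (actD g v) i j = s i * vec_mx v (p i) j.
  by rewrite /actD mxvecK (signed_perm_mulz _ _ _ gps).
split=> [l|i|i j e ij].
- case/mxvec_indexP: l => i j.
  have := aE i j; rewrite mxE => ->; rewrite mxE.
  by case: (s1 i) => ->; rewrite ?mul1r ?mulN1r ?normrN.
- have [j vj] := v0 (p i); exists j; rewrite aE.
  by case: (s1 i) => ->; rewrite ?mul1r ?mulN1r ?oppr_eq0.
have [c cP] := vN (p i) (p j) (e (+) (s i != s j)) (contra_neq (@pinj i j) ij).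
exists c; rewrite !aE; move: cP.
by case: (s1 i) => ->; case: (s1 j) => ->; case: e;
  rewrite ?expr0 ?expr1 ?mul1r ?mulN1r ?opprK ?(inj_eq oppr_inj) // eqr_oppLR
    ?opprK.
Qed.

Lemma good_free g h v : good v -> actD g v = actD h v -> g = h.
Proof.
case=> vB v0 vN gh; have [p [s gps]] := signed_perm_exists g.
have [q [t hqt]] := signed_perm_exists h.
have [_ s1 gE] := gps; have [_ t1 hE] := hqt.
have E i j : s i * vec_mx v (p i) j = t i * vec_mx v (q i) j.
  rewrite -(signed_perm_mulz _ _ _ gps) -(signed_perm_mulz _ _ _ hqt).
  by have := congr1 (fun w => vec_mx w i j) gh; rewrite /actD !mxvecK.
have pq i : p i = q i.
  apply/eqP; apply: contraT => pqi.
  have [c] := vN _ _ (s i != t i) pqi; have := E i c.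
  by case: (s1 i) => ->; case: (t1 i) => ->;
    rewrite /= ?expr0 ?expr1 => E0 /eqP; lia.
have st i : s i = t i.
  have [j vj] := v0 (p i); have := E i j; rewrite -pq => /eqP.
  by rewrite (inj_eq (mulIf vj)) => /eqP.
by apply/val_inj/matrixP => i j; rewrite gE hE pq st.
Qed.

End GoodVertices.

(** * The quadratic map made affine near its zeros *)

Section BaseMap.
Variables (R : realType) (k r M : nat).
Hypotheses (k_gt0 : (0 < k)%N) (M_gt0 : (0 < M)%N).
Local Notation n := (k + r)%N.
Local Notation d := (k * (k + r))%N.
Local Notation W := ('M[R]_k * 'M[R]_k * 'M[R]_(k, r))%type.
Local Notation mesh := (mesh R M).
Local Notation rX := (@rX R k r M).
Local Notation close_at := (@close_at R k r M).
Local Notation good := (@good k n M.*2.*2).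
Local Notation frame0 := (frame0 R k r).
Implicit Types (g : sperm k) (v : 'rV[int]_(k * (k + r))).

Lemma close_at_good g v : close_at 4%:R^-1 g v -> good v.
Proof.
move=> gv; rewrite -(actDV g v); apply: good_actD.
have E i j : vec_mx (actD g v) i j =
  actD g v 0 (mxvec_index i j) by rewrite mxE.
have m0 := mesh_gt0 R M_gt0.
have near0 i j : `|mesh * (vec_mx (actD g v) i j)%:~R - frame0 i j| < 4%:R^-1.
  by have := gv i j; rewrite -rX_actD mxE [(- frame0) i j]mxE rXE E.
have f00 i j : `|frame0 i j| <= 1.
  rewrite /frame0; case: (split_ordP j) => j' ->;
    rewrite ?row_mxEl ?row_mxEr mxE.
    by case: (i == j'); rewrite ?normr1 ?normr0 ?ler01.
  by rewrite normr0.
have f0d i : frame0 i (lshift r i) = 1 by rewrite /frame0 row_mxEl mxE eqxx.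
have f0n i j : i != j -> frame0 i (lshift r j) = 0.
  by move=> ij; rewrite /frame0 row_mxEl mxE (negPf ij).
split=> [l|i|i j e ij].
- case/mxvec_indexP: l => i j; rewrite -E.
  have : `|mesh * (vec_mx (actD g v) i j)%:~R| < 2.
    have := ler_normD (mesh * (vec_mx (actD g v) i j)%:~R - frame0 i j)
      (frame0 i j).
    by rewrite subrK; have := near0 i j; have := f00 i j; lra.
  rewrite normrM (gtr0_norm m0) mulrC -ltr_pdivlMr // invrK -natrM -intr_norm.
  by rewrite mul2n -[_%:R]/((M.*2.*2)%:Z%:~R) ltr_int.
- exists (lshift r i); apply/eqP => e0; have := near0 i (lshift r i).
  by rewrite e0 mulr0 f0d sub0r normrN normr1; lra.
exists (lshift r i); apply/eqP => e0.
have := near0 i (lshift r i); have := near0 j (lshift r i).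
rewrite f0d f0n 1?eq_sym // subr0 e0 intrM mulrCA => h1 h2.
have h3 : `|((-1) ^+ e)%:~R * (mesh * (vec_mx (actD g v) j (lshift r i))%:~R)
  : R| < 4%:R^-1.
  rewrite normrM; case: (e);
    rewrite ?expr0 ?expr1 ?mulrN1z ?normrN normr1 mul1r //.
by move: h2 h3; rewrite !ltr_norml => /andP[? ?] /andP[? ?]; lra.
Qed.

(** [mesh] times the barycentre of the alcove whose vertex [i] has entries [(l < i)]: the average
    over [i] of coordinate [l] is [(d - l) / d.+1]. *)
Definition shift : 'M[R]_(k, n) :=
  vec_mx (\row_l (mesh * (1 - l.+1%:R / d.+1%:R))).

Lemma shift_le i j : `|shift i j| <= mesh.
Proof.
have m0 := mesh_gt0 R M_gt0.
rewrite !mxE normrM (gtr0_norm m0) ler_piMr ?(ltW m0) //.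
have lt1 : (mxvec_index i j).+1%:R / d.+1%:R <= 1 :> R.
  by rewrite ler_pdivrMr ?ltr0n // mul1r ler_nat ltnS ltnW.
have ge0 : 0 <= (mxvec_index i j).+1%:R / d.+1%:R :> R by rewrite divr_ge0.
by move: (_ / _) lt1 ge0 => x lt1 ge0; rewrite ger0_norm; lra.
Qed.

Variable del : R.
Hypothesis del_le : del <= 4%:R^-1.

(* Near its zeros [quad] is replaced by its linear part, slightly shifted, so that
   up to symmetry a single alcove contains a zero, robustly. *)
Definition basemap v : W :=
  if pselect (exists g, close_at del g v) is left gv then
    let g := sval (cid gv) in
    actT R r (sperm_inv g) (lin_fun (sR R g *m rX v - frame0 - shift))
  else quad (rX v).

Lemma basemap_close g v : close_at del g v ->
  basemap v = actT R r (sperm_inv g) (lin_fun (sR R g *m rX v - frame0 -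
    shift)).
Proof.
move=> gv; rewrite /basemap; case: pselect => [ex|[]] /=; last by exists g.
have hv := svalP (cid ex).
have -> // : sval (cid ex) = g.
have dd : del + del <= 1 by apply: le_trans (lerD del_le del_le) _; lra.
exact: (close_at_uniq M_gt0 dd hv gv).
Qed.

Lemma basemap_far v : ~ (exists g, close_at del g v) -> basemap v = quad (rX v).
Proof. by move=> nv; rewrite /basemap; case: pselect. Qed.

Lemma basemap_in v : basemap v \in targetU R k r.
Proof.
rewrite /basemap; case: pselect => [gv|_] /=; last exact: quad_in.
exact/actT_in/lin_fun_in.
Qed.

Lemma close_at_actD e g h v :
  close_at e g (actD h v) <-> close_at e (sperm_mul g h) v.
Proof.
rewrite /close_at.
by split=> gv i j; have := gv i j; rewrite rX_actD sR_mul mulmxA.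
Qed.

Lemma basemap_actD g v : basemap (actD g v) = actT R r g (basemap v).
Proof.
have [[h hv]|nv] := pselect (exists h, close_at del h v).
  rewrite (basemap_close hv).
  have hgv : close_at del (sperm_mul h (sperm_inv g)) (actD g v).
    apply/close_at_actD; suff ->
      : sperm_mul (sperm_mul h (sperm_inv g)) g = h by [].
    by apply/val_inj; rewrite /= -mulmxA sperm_VK mulmx1.
  rewrite (basemap_close hgv) rX_actD sR_mul sR_inv.
  rewrite -[_ *m (_ *m rX v)]mulmxA [(_)^T *m _]mulmxA sR_VK mul1mx -actTM.
  congr (actT _ _ _ _); apply/val_inj => /=.
  by rewrite trmx_mul trmxK.
rewrite (basemap_far nv) basemap_far ?rX_actD ?quad_sR // => -[h hv].
apply: nv; exists (sperm_mul h g).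
by have [H _] := close_at_actD del h g v; exact: H.
Qed.

End BaseMap.

(** * Zero flags of small perturbations of the base map *)

Section BaseZeroFlags.
Variables (R : realType) (k r M : nat).
Hypotheses (k_gt0 : (0 < k)%N) (M_gt0 : (0 < M)%N).
Local Notation n := (k + r)%N.
Local Notation d := (k * (k + r))%N.
Local Notation W := ('M[R]_k * 'M[R]_k * 'M[R]_(k, r))%type.
Local Notation mesh := (mesh R M).
Local Notation rX := (@rX R k r M).
Local Notation close_at := (@close_at R k r M).
Local Notation good := (@good k n M.*2.*2).
Local Notation frame0 := (frame0 R k r).
Local Notation shift := (shift R k r M).
Implicit Types (g : sperm k) (v : 'rV[int]_(k * (k + r))).

(** Within twice this radius the quadratic remainder is at most [d (2 radius)^2]; after the loss of
    a factor [k.+1] in [lin_inv], the constant 64 leaves [radius / 16]. *)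
Definition radius : R := (64%:R * k.+1%:R * d%:R)^-1.

Local Notation bmap := (@basemap R k r M radius).
Hypothesis mesh_le : mesh <= radius / 8%:R.
Variable e : R.
Hypothesis e_le : k.+1%:R * e <= mesh * (8%:R^-1 / d.+1%:R).
Variable F : 'rV[int]_d -> W.
Hypotheses (F_approx : forall v, `|F v - bmap v| <= e)
  (F_in : forall v, good v -> F v \in targetU R k r)
  (F_far : forall s : flag d M.*2,
    (forall i : 'I_d.+1, ~ exists g, close_at radius g (vert s i)) ->
    exists h : 'Hom(W, R^o), (forall w, `|h w| <= `|w|) /\
      forall i : 'I_d.+1, e < h (quad (rX (vert s i)))).

Lemma grid_dim_gt0 : (0 < d)%N.
Proof. by rewrite muln_gt0 k_gt0 addn_gt0 k_gt0. Qed.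

Lemma radius_gt0 : 0 < radius.
Proof. by rewrite invr_gt0 !mulr_gt0 ?ltr0n ?grid_dim_gt0. Qed.

Lemma radiusM : k.+1%:R * (d%:R * radius) = 64%:R^-1.
Proof.
have d0 : d%:R != 0 :> R by rewrite pnatr_eq0 -lt0n grid_dim_gt0.
have k0 : k.+1%:R != 0 :> R by rewrite pnatr_eq0.
rewrite /radius; move: (d%:R) (k.+1%:R) d0 k0 => x y x0 y0.
by field; apply/andP.
Qed.

Lemma radius_le : radius <= 64%:R^-1.
Proof.
rewrite -radiusM mulrA ler_peMl ?(ltW radius_gt0) // -natrM ler1n muln_gt0.
by rewrite grid_dim_gt0.
Qed.

Lemma noise_le (w : W) g : `|w| <= e ->
  forall i j, `|lin_inv (actT R r g w) i j| <= mesh * (8%:R^-1 / d.+1%:R).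
Proof.
move=> we i j; apply: le_trans e_le; apply: le_trans (lin_inv_le _ _ _) _.
by rewrite ler_wpM2l // (le_trans (actT_le _ _)).
Qed.

Lemma noise_small : mesh * (8%:R^-1 / d.+1%:R) <= radius / 8%:R.
Proof.
apply: le_trans mesh_le; rewrite ler_piMr ?(ltW (mesh_gt0 R M_gt0)) //.
rewrite ler_pdivrMr ?ltr0n // mul1r (@le_trans _ _ 1) ?ler1n //; lra.
Qed.

Let E0 : 'rV[int]_d := mxvec (row_mx 1%:M 0).
Let b (l : 'I_d) : int := E0 0 l * M%:Z.

Lemma frame0E i j : frame0 i j = mesh * (b (mxvec_index i j) *+ 2)%:~R.
Proof.
have -> : b (mxvec_index i j) *+ 2 = E0 0 (mxvec_index i j) * M.*2.
  by rewrite /b -mul2n; lia.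
rewrite meshM // /E0 mxvecE /frame0.
case: (split_ordP j) => j' ->; rewrite ?row_mxEl ?row_mxEr !mxE //.
by case: (i == j').
Qed.

(** The alcove at [frame0] with positive signs and the identity order, the one that contains the
    shifted zero. The offset [M.*2] undoes the recentring in [vert]. *)
Definition zero_flag0 : flag d M.*2 :=
  ([ffun l => inord (M.*2 + (if E0 0%R l == 1%R then M else 0))%N],
   [ffun=> false], 1%g).

Lemma E0_01 l : E0 0 l = 1 \/ E0 0 l = 0.
Proof.
case/mxvec_indexP: l => i j; rewrite /E0 mxvecE.
case: (split_ordP j) => j' ->; rewrite ?row_mxEl ?row_mxEr mxE; last by right.
by case: (i == j'); [left|right].
Qed.

Lemma vert_zero_flag0 i l : vert zero_flag0 i 0 l = b l *+ 2 + (l < i)%:R.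
Proof.
rewrite mxE /= !ffunE perm1 expr0 mul1r; congr (_ *+ 2 + _).
rewrite inordK /b; case: (E0_01 l) => ->; rewrite /=; lia.
Qed.

Lemma close_step g (s : flag d M.*2) i j a c :
  `|(sR R g *m rX (vert s i) - frame0) a c -
    (sR R g *m rX (vert s j) - frame0) a c| <= mesh.
Proof.
have [p [t gpt]] := signed_perm_exists g.
rewrite -2!rX_actD !mxE opprD addrACA subrr addr0 -!rXE !rX_actD.
rewrite !(sR_mulE _ _ _ gpt) -mulrBr normrM (signed_perm_norm _ _ gpt) mul1r.
rewrite !rXE -mulrBr -rmorphB /= normrM gtr0_norm ?mesh_gt0 //.
apply: ler_piMr; first exact/ltW/mesh_gt0.
by rewrite -intr_norm -[leRHS]mulr1z ler_int vert_step.
Qed.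

Lemma close_spread g (s : flag d M.*2) i j :
  close_at radius g (vert s i) -> close_at (radius + mesh) g (vert s j).
Proof.
move=> gi a c; have := gi a c; have := close_step g s j i a c.
move: ((_ *m _ - _) a c) ((_ *m _ - _) a c) => y x h1 h2.
by rewrite -(subrK y x) (le_lt_trans (ler_normD _ _)) // addrC ltr_leD.
Qed.

Lemma lin_inv_basemap g v : close_at radius g v ->
  lin_inv (actT R r g (bmap v)) =
    sR R g *m rX v - frame0 - shift.
Proof.
move=> gv; rewrite (basemap_close M_gt0 _ gv) ?actT_Kinv ?lin_funK //.
by apply: le_trans radius_le _; lra.
Qed.

(** A flag may straddle the cutoff, with affine values at some vertices and quadratic ones at
    others. Both differ from the unshifted linear part by at most [radius / 8]: by the shift in one
    case, by the quadratic remainder in the other. *)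
Lemma lin_inv_basemap_approx g v i j : close_at (radius + mesh) g v ->
  `|lin_inv (actT R r g (bmap v)) i j -
    (sR R g *m rX v - frame0) i j| <= radius / 8%:R.
Proof.
move=> gv; have rad0 := radius_gt0; have rad1 := radius_le.
have [[h hv]|nv] := pselect (exists h, close_at radius h v).
  have gh : g = h.
    apply: (close_at_uniq M_gt0 _ gv hv); move: mesh_le; lra.
  subst h; rewrite (lin_inv_basemap hv) [_ i j]mxE addrAC subrr add0r.
  by rewrite mxE normrN; exact: le_trans (shift_le R M_gt0 i j) mesh_le.
rewrite (basemap_far nv) -quad_sR; set X := sR R g *m rX v.
rewrite -[X in quad X](subrKC frame0) quad_frame0D linearD /= lin_funK.
rewrite mxE addrAC subrr add0r (le_trans (lin_inv_le _ _ _)) //.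
have z2 a c : `|(X - frame0) a c| <= radius * 2.
  by apply: ltW; apply: lt_le_trans (gv a c) _; move: mesh_le; lra.
apply: (@le_trans _ _ (k.+1%:R * (d%:R * (radius * 2) ^+ 2))).
  by rewrite ler_wpM2l // quad_rest_le.
have -> : k.+1%:R * (d%:R * (radius * 2) ^+ 2) =
    (k.+1%:R * (d%:R * radius)) * radius * 4%:R by ring.
by rewrite radiusM; lra.
Qed.

Section OneFlag.
Variables (s : flag d M.*2) (g : sperm k) (i0 : 'I_d.+1).
Hypothesis gi0 : close_at radius g (vert s i0).
Variable c : 'I_d.+1 -> R.
Hypotheses (c_gt0 : forall i, 0 < c i) (c1 : \sum_i c i = 1)
  (c_dep : \sum_i c i *: F (vert s i) = 0).

Let z (i : nat) := sR R g *m rX (vert s i) - frame0.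
Let x (i : 'I_d.+1) := lin_inv (actT R r g (F (vert s i))).

Let x_dep a l : \sum_i c i * x i a l = 0.
Proof.
have : \sum_i c i *: x i = 0.
  have -> : \sum_i c i *: x i =
    lin_inv (actT R r g (\sum_i c i *: F (vert s i))).
    rewrite linear_sum linear_sum; apply: eq_bigr => i _.
    by rewrite 2!linearZ.
  by rewrite c_dep 2!linear0.
move/matrixP/(_ a l); rewrite summxE mxE => sum0; rewrite -[RHS]sum0.
by apply: eq_bigr => i _; rewrite [RHS]mxE.
Qed.

Let x_split i : x i = lin_inv (actT R r g (F (vert s i) - bmap (vert s i)))
  + lin_inv (actT R r g (bmap (vert s i))).
Proof. by rewrite -!linearD /= subrK. Qed.

Let wavg (f : 'I_d.+1 -> R) (t : R) : (forall i, `|f i| <= t) ->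
  `|\sum_i c i * f i| <= t.
Proof.
move=> ft; rewrite (le_trans (ler_norm_sum _ _ _)) //.
rewrite -[leRHS]mul1r -c1 mulr_suml; apply: ler_sum => i _.
by rewrite normrM gtr0_norm // ler_wpM2l // ltW.
Qed.

(** Since the values cancel, [z j] is an average of steps of the mesh and of approximation errors,
    at most [3 radius / 8]. A zero flag that meets the affine zone is thus contained in it. *)
Let all_close (j : 'I_d.+1) : close_at radius g (vert s j).
Proof.
move=> a l; change (`|z j a l| < radius).
have -> : z j a l = \sum_i c i * ((z j a l - z i a l) + (z i a l - x i a l)).
  under eq_bigr do rewrite addrA subrK mulrBr.
  by rewrite sumrB x_dep subr0 -mulr_suml c1 mul1r.
apply: (@le_lt_trans _ _ (radius / 2)); last by move: radius_gt0; lra.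
apply: wavg => i; rewrite (le_trans (ler_normD _ _)) //.
have h1 := close_step g s j i a l.
have h2 : `|z i a l - x i a l| <= radius / 8%:R + radius / 8%:R.
  rewrite distrC x_split mxE -addrA (le_trans (ler_normD _ _)) // lerD //.
    exact/(le_trans _ noise_small)/noise_le.
  exact/lin_inv_basemap_approx/close_spread/gi0.
have rad0 := radius_gt0; move: h1 h2 mesh_le; rewrite -/(z j) -/(z i); lra.
Qed.

(** On the affine zone the dependence says that an average of the vertices equals [frame0 + shift]
    up to noise. In units of [mesh], consecutive coordinates of [shift] are [1 / d.+1] apart and the
    noise is at most an eighth of that, so [flaglike_eq] still applies. *)
Lemma close_zero_flag : forall i : 'I_d.+1,
  vert s i = actD (sperm_inv g) (vert zero_flag0 i).
Proof.
pose w i := lin_inv (actT R r g (F (vert s i) - bmap (vert s i))).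
have m0 := mesh_gt0 R M_gt0.
have D0 : 0 < d.+1%:R^-1 :> R by rewrite invr_gt0 ltr0n.
pose eta a l := \sum_i c i * (w i a l / mesh).
have eta_le a l : `|eta a l| <= 8%:R^-1 / d.+1%:R.
  apply: wavg => i; rewrite normrM normfV (gtr0_norm m0) ler_pdivrMr // mulrC.
  exact: noise_le.
have key a l : \sum_(i < d.+1) c i * (actD g (vert s i) 0 (mxvec_index a
  l))%:~R =
    (b (mxvec_index a l) *+ 2)%:~R +
      (1 - (mxvec_index a l).+1%:R / d.+1%:R - eta a l) :> R.
  apply: (mulfI (lt0r_neq0 m0)); rewrite mulrDr -frame0E mulr_sumr.
  have E (i : 'I_d.+1) : mesh * (c i * (actD g (vert s i) 0 (mxvec_index a
    l))%:~R) =
      c i * x i a l + c i * (frame0 a l +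
        shift a l) - mesh * (c i * (w i a l / mesh)).
    have -> : x i a l = w i a l +
      (rX (actD g (vert s i)) a l - frame0 a l - shift a l).
      by rewrite x_split (lin_inv_basemap (all_close i)) rX_actD !mxE.
    by rewrite rXE; field; exact: lt0r_neq0.
  rewrite (eq_bigr _ (fun i _ => E i)) sumrB big_split /= x_dep add0r.
  rewrite -mulr_suml c1 mul1r -mulr_sumr -/(eta a l).
  by rewrite !mulrBr !mxE mulrBr; ring.
have [f fK gK] := curry_mxvec_bij k n.
pose t (l : 'I_d) := 1 - l.+1%:R / d.+1%:R - eta (f l).1 (f l).2.
have DD : d.+1%:R / d.+1%:R = 1 :> R by rewrite divff // pnatr_eq0.
have fP : flaglike (fun i =>
  actD g (vert s i)) by apply/flaglike_actD/flaglike_vert.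
have tP l : - (8%:R^-1 / d.+1%:R) <= eta (f l).1 (f l).2 <= 8%:R^-1 / d.+1%:R.
  by rewrite -ler_norml.
have step (p q : nat) : (p < q)%N ->
  p%:R / d.+1%:R + d.+1%:R^-1 <= q%:R / d.+1%:R :> R.
  by move=> pq; rewrite -{2}[d.+1%:R^-1]mul1r -mulrDl natr1 ler_pM2r // ler_nat.
have avg l : \sum_(i < d.+1) c i * (actD g (vert s i) 0 l)%:~R =
  (b l *+ 2)%:~R + t l.
  case/mxvec_indexP: l => a l; rewrite key /t.
  by have -> : f (mxvec_index a l) = (a, l) by exact: fK (a, l) isT.
have t01 l : 0 < t l < 1.
  have /andP[t1 t2] := tP l;
    have := step l.+1 d.+1 (ltn_ord l : (l.+1 < d.+1)%N).
  have := step 0%N l.+1 isT; rewrite DD mul0r add0r /t.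
  move: (l.+1%:R / _) (eta _ _) t1 t2 D0 => q y.
  by move: (d.+1%:R^-1) => u *; apply/andP; split; lra.
have t_decr (l m : 'I_d) : (l < m)%N -> t m < t l.
  move=> lm; have /andP[t1 t2] := tP l; have /andP[t3 t4] := tP m.
  have := step l.+1 m.+1 lm; rewrite /t.
  move: (l.+1%:R / _) (m.+1%:R / _) (eta _ _) (eta _ _) t1 t2 t3 t4 D0 =>
    q q' y y'.
  by move: (d.+1%:R^-1) => u *; lra.
have H := flaglike_eq fP c_gt0 c1 avg t01 t_decr.
move=> i; rewrite -[LHS](actDV g); congr (actD _ _); apply/rowP => l.
by rewrite H vert_zero_flag0.
Qed.

End OneFlag.

Lemma zero_flag0_uniq (s : flag d M.*2) :
    pos_dep xpredT (fun i : 'I_d.+1 => F (vert s i)) ->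
  exists g, forall i : 'I_d.+1, vert s i = actD g (vert zero_flag0 i).
Proof.
case=> c [c_gt0 c_dep]; pose S := \sum_i c i.
have S_gt0 : 0 < S.
  rewrite /S (bigD1 ord0) //= ltr_pwDl ?c_gt0 //.
  by apply: sumr_ge0 => i _; exact/ltW/c_gt0.
have [[i [g gi]]|far] := pselect (exists (i : 'I_d.+1) g,
  close_at radius g (vert s i)).
  exists (sperm_inv g); apply: (close_zero_flag gi (c := fun i => c i / S)).
  - by move=> j; rewrite divr_gt0 // c_gt0.
  - by rewrite -mulr_suml divff // gt_eqF.
  under eq_bigr do rewrite mulrC -scalerA.
  by rewrite -scaler_sumr c_dep scaler0.
have [|h [hN hP]] := F_far (s := s).
  by move=> i [g gi]; apply: far; exists i, g.
have hD x y : h (x + y) = h x + h y :> R by rewrite linearD.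
have hF (i : 'I_d.+1) : 0 < h (F (vert s i)).
  have qE : bmap (vert s i) = quad (rX (vert s i)).
    by apply: basemap_far => -[g gi]; apply: far; exists i, g.
  have -> : F (vert s i) = quad (rX (vert s i)) +
    (F (vert s i) - bmap (vert s i)).
    by rewrite qE addrC subrK.
  have := hN (F (vert s i) - bmap (vert s i)).
  move/le_trans/(_ (F_approx _)); rewrite ler_norml => /andP[+ _].
  by rewrite hD; have := hP i; lra.
have : h (\sum_i c i *: F (vert s i)) == 0 by rewrite c_dep linear0.
rewrite linear_sum gt_eqF // (bigD1 ord0) //=.
have hc i : 0 < h (c i *: F (vert s i)).
  by rewrite linearZ; apply: mulr_gt0 (hF i); exact: c_gt0.
apply: ltr_pwDl; first exact: hc.
by apply: sumr_ge0 => i _; exact/ltW/hc.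
Qed.

Lemma ord_dependent (x : 'I_d.+1 -> 'M[R]_(k, n)) :
  exists c : 'I_d.+1 -> R, (exists i, c i != 0) /\ \sum_i c i *: x i = 0.
Proof.
pose A := \matrix_(i < d.+1) mxvec (x i).
have : kermx A != 0.
  by rewrite kermx_eq0 -row_leq_rank -ltnNge ltnS rank_leq_col.
case/rowV0Pn => v /sub_kermxP vA v0.
exists (fun i => v 0 i); split.
  have /rV0Pn[i vi] := v0; by exists i.
apply: (can_inj mxvecK); rewrite linear0 linear_sum /= -[RHS]vA mulmx_sum_row.
by apply: eq_bigr => i _; rewrite linearZ rowK.
Qed.

Lemma zero_flag0_close i : (i <= d)%N ->
  forall a l, (sR R (sperm_one k) *m rX (vert zero_flag0 i) - frame0) a l =
    mesh * (mxvec_index a l < i)%:R.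
Proof.
move=> id a l; rewrite -rX_actD actD1 mxE rXE [(- frame0) a l]mxE frame0E.
rewrite vert_zero_flag0 rmorphD mulrDr addrAC subrr add0r.
by case: (_ < _)%N.
Qed.

(** The [d.+1] values lie in a space of dimension [d], hence are dependent; as the zero sits near
    the barycentre, [barycentric_sign] gives all coefficients the same sign. *)
Lemma zero_flag0_exists : pos_dep xpredT (fun i : 'I_d.+1 =>
  F (vert zero_flag0 i)).
Proof.
have m0 := mesh_gt0 R M_gt0; have rad0 := radius_gt0; have rad1 := radius_le.
have close1 (i : 'I_d.+1) : close_at radius (sperm_one k) (vert zero_flag0 i).
  move=> a l; rewrite zero_flag0_close -1?ltnS // normrM gtr0_norm //.
  apply: (@le_lt_trans _ _ mesh); last by move: mesh_le; lra.
  apply: ler_piMr; first exact: ltW.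
  by case: (_ < _)%N; rewrite ?normr1 ?normr0.
have Fin (i : 'I_d.+1) : F (vert zero_flag0 i) \in targetU R k r.
  apply/F_in/(close_at_good M_gt0 (g := sperm_one k)) => a l.
  by apply: lt_le_trans (close1 i a l) _; lra.
pose x (i : 'I_d.+1) := lin_inv (F (vert zero_flag0 i)).
have [c [c0 c_dep]] := ord_dependent x.
have Fdep : \sum_i c i *: F (vert zero_flag0 i) = 0.
  have -> : \sum_i c i *: F (vert zero_flag0 i) = lin_fun (\sum_i c i *: x i).
    rewrite lin_fun_sum; apply: eq_bigr => i _; congr (_ *: _).
    by rewrite /x lin_invK //; exact/targetUP.
  rewrite c_dep; exact: linear0.
have a1 w : actT R r (sperm_one k) w = w.
  by rewrite actTE /actT_fun /sR /= map_mx1 !mul1mx trmx1 !mulmx1;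
    case: w => -[].
pose w (i : 'I_d.+1) := lin_inv (F (vert zero_flag0 i) - bmap (vert zero_flag0
  i)).
have w_le (i : 'I_d.+1) a l : `|w i a l| <= mesh * (8%:R^-1 / d.+1%:R).
  by have := noise_le (sperm_one k) (F_approx (vert zero_flag0 i)) a l;
    rewrite a1.
have xE (i : 'I_d.+1) a l : x i a l = mesh * ((mxvec_index a l < i)%:R -
    (1 - (mxvec_index a l).+1%:R / d.+1%:R) + w i a l / mesh).
  have -> : x i = w i + lin_inv (bmap (vert zero_flag0 i)).
    by rewrite -linearD /= subrK.
  rewrite -[bmap _]a1 lin_inv_basemap // mxE [(_ - shift) a l]mxE
    zero_flag0_close -1?ltnS //.
  have -> : (- shift) a l = - (mesh * (1 - (mxvec_index a l).+1%:R / d.+1%:R)).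
    by rewrite !mxE.
  move: (w i a l) (_ / d.+1%:R) => y q; field; exact: lt0r_neq0.
have [f fK gK] := curry_mxvec_bij k n.
have [|i l|l|c_gt0|c_lt0] :=
  @barycentric_sign R d c (fun i l => w i (f l).1 (f l).2 / mesh).
- by [].
- rewrite normrM normfV (gtr0_norm m0) ler_pdivrMr // mulrC.
  exact: w_le.
- case/mxvec_indexP: l => a l.
  have -> : f (mxvec_index a l) = (a, l) by exact: fK (a, l) isT.
  apply: (mulfI (lt0r_neq0 m0)); rewrite mulr0 mulr_sumr.
  have /matrixP/(_ a l) := c_dep; rewrite summxE mxE => sum0;
    rewrite -[RHS]sum0.
  by apply: eq_bigr => i _; rewrite [RHS]mxE xE mulrCA.
- by exists c; split.
exists (fun i => - c i); split=> [i _|]; first by rewrite oppr_gt0.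
by under eq_bigr do rewrite scaleNr; rewrite sumrN Fdep oppr0.
Qed.

End BaseZeroFlags.

(** * Vertices with nontrivial stabilizer *)

Section EntryFunctionals.
Variables (R : realType) (k r : nat).
Local Notation W := ('M[R]_k * 'M[R]_k * 'M[R]_(k, r))%type.

Definition entry_index := ('I_k * 'I_k + 'I_k * 'I_k + 'I_k * 'I_r)%type.

(** Signed coordinates serve as separating functionals: they do not exceed the norm, and at any
    nonzero vector one of them is positive. *)
Definition entry (b : bool) (x : entry_index) (w : W) : R^o :=
  (-1) ^+ b * match x with
  | inl (inl (i, j)) => w.1.1 i j
  | inl (inr (i, j)) => w.1.2 i j
  | inr (i, j) => w.2 i j
  end.

Lemma entry_linear b x : linear (entry b x).
Proof.
move=> a u v; transitivity (a * entry b x u + entry b x v); last by [].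
by rewrite /entry; case: x => [[[i j]|[i j]]|[i j]]; rewrite /= !mxE; ring.
Qed.

HB.instance Definition _ b x :=
  GRing.isLinear.Build R W R^o _ _ (entry_linear b x).

Definition entry_hom b x : 'Hom(W, R^o) := linfun (entry b x).

Lemma entry_homE b x w : entry_hom b x w = entry b x w.
Proof. by rewrite lfunE. Qed.

Lemma entry_hom_le b x w : `|entry_hom b x w| <= `|w|.
Proof.
rewrite entry_homE /entry normrM normrX normrN1 expr1n mul1r.
by have [h1 h2 h3] := le_target_norm w; case: x => [[[i j]|[i j]]|[i j]].
Qed.

Lemma entry_pos (w : W) : w != 0 -> exists b x, 0 < entry_hom b x w.
Proof.
move=> w0; have [x wx] : exists x, entry false x w != 0.
  apply/not_existsP => nx; move/negP: w0; apply; apply/eqP.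
  have e0 x : entry false x w = 0 by apply/eqP/negPn/negP/nx.
  case: w nx e0 => -[A B] C nx e0; congr (_, _, _); apply/matrixP => i j;
    rewrite mxE.
  - by have := e0 (inl (inl (i, j))); rewrite /entry mul1r.
  - by have := e0 (inl (inr (i, j))); rewrite /entry mul1r.
  - by have := e0 (inr (i, j)); rewrite /entry mul1r.
exists (entry false x w < 0), x; rewrite entry_homE.
have -> b : entry b x w = (-1) ^+ b * entry false x w.
  by rewrite /entry mul1r.
have [w_lt0|w_ge0] := ltrP (entry false x w) 0;
  first by rewrite mulN1r oppr_gt0.
by rewrite mul1r lt_neqAle eq_sym wx.
Qed.

End EntryFunctionals.

(** * Gram entries at vertices that are not good *)

Section GramSeparation.
Variables (R : realType) (k r M : nat).
Hypothesis M_gt0 : (0 < M)%N.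
Local Notation n := (k + r)%N.
Local Notation d := (k * (k + r))%N.
Local Notation mesh := (mesh R M).
Local Notation rX := (@rX R k r M).
Hypothesis mesh_le : 6%:R * n%:R * mesh <= 8%:R^-1.

Definition gram (X : 'M[R]_(k, n)) : 'M[R]_k := X *m X^T - 1%:M.

Lemma gramE X a b : gram X a b = \sum_l X a l * X b l - (a == b)%:R.
Proof. by rewrite !mxE; congr (_ - _); apply: eq_bigr => l _; rewrite mxE. Qed.

Lemma rX_le3 (s : flag d M.*2) i a l : `|rX (vert s i) a l| <= 3%:R.
Proof.
have m0 := mesh_gt0 R M_gt0.
rewrite rXE normrM gtr0_norm // mulrC -ler_pdivlMr // invrK -intr_norm.
rewrite -natrM -[_%:R]/((3 * M.*2)%N%:Z%:~R) ler_int.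
have := vert_bound s i (mxvec_index a l); lia.
Qed.

Lemma rX_step (s : flag d M.*2) i j a l :
  `|rX (vert s i) a l - rX (vert s j) a l| <= mesh.
Proof.
have m0 := mesh_gt0 R M_gt0.
rewrite !rXE -mulrBr -rmorphB /= normrM gtr0_norm //.
apply: ler_piMr; first exact: ltW.
by rewrite -intr_norm -[leRHS]mulr1z ler_int vert_step.
Qed.

Lemma gram_step (s : flag d M.*2) i j a b :
  `|gram (rX (vert s i)) a b - gram (rX (vert s j)) a b| <= 8%:R^-1.
Proof.
apply: le_trans mesh_le; rewrite !gramE opprB addrA subrK -sumrB.
apply: le_trans (ler_norm_sum _ _ _) _.
apply: (@le_trans _ _ (\sum_(l < n) 6%:R * mesh)); last first.
  by rewrite sumr_const card_ord -[_ *+ n]mulr_natr mulrAC.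
apply: ler_sum => l _.
set x := rX _ a l; set y := rX _ b l; set x' := rX _ a l; set y' := rX _ b l.
(* Entries are at most 3 and vary by at most [mesh], so each product varies by at most [6 mesh]. *)
have -> : x * y - x' * y' = x * (y - y') + (x - x') * y' by ring.
apply: le_trans (ler_normD _ _) _; rewrite !normrM.
have -> : 6%:R * mesh = 3%:R * mesh + mesh * 3%:R by ring.
by rewrite lerD // ler_pM // ?rX_le3 ?rX_step.
Qed.

(** If all Gram entries were below 1/2 in absolute value, the rows would have square norm between
    1/2 and 3/2. This bounds the entries by 2 and excludes zero rows, and two rows equal up to sign
    would have an inner product above 1/2 in absolute value. *)
Lemma gram_bad v : ~ good M.*2.*2 v ->
  exists (a b : 'I_k) (e : bool), 2^-1 <= (-1) ^+ e * gram (rX v) a b.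
Proof.
have m0 := mesh_gt0 R M_gt0.
have vE i j : vec_mx v i j = v 0 (mxvec_index i j) by rewrite mxE.
move=> bad; apply: contrapT => noab.
have lt_half a b (e : bool) : (-1) ^+ e * gram (rX v) a b < 2^-1.
  by rewrite ltNge; apply/negP => h; apply: noab; exists a, b, e.
have gramaa a : \sum_l rX v a l ^+ 2 < 2 /\ 2^-1 < \sum_l rX v a l ^+ 2.
  have := lt_half a a false; have := lt_half a a true;
    rewrite gramE eqxx -[true%:R]/(1 : R).
  rewrite (eq_bigr (fun l => rX v a l ^+ 2)) // expr0 expr1 => h1 h2.
  by split; lra.
apply: bad; split=> [l|i|i j e ij].
- case/mxvec_indexP: l => a l.
  have le_sq : rX v a l ^+ 2 <= \sum_l rX v a l ^+ 2.
    by rewrite (bigD1 l) //= lerDl sumr_ge0 // => l' _; exact: sqr_ge0.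
  have : `|rX v a l| < 2.
    rewrite ltNge; apply/negP => ge2; have [lt2 _] := gramaa a.
    have : (2 * 2 : R) <= rX v a l ^+ 2 by rewrite -real_normK ?num_real //
      expr2 ler_pM.
    by lra.
  rewrite rXE normrM (gtr0_norm m0) mulrC -ltr_pdivlMr // invrK -natrM
    -intr_norm.
  by rewrite mul2n -[_%:R]/((M.*2.*2)%:Z%:~R) ltr_int.
- apply: contrapT => vi0; have [_] := gramaa i; rewrite big1 => [|l _];
  first by lra.
  have -> : rX v i l = 0; last by rewrite expr0n.
  apply/eqP; apply: contrapT => /negP vil; apply: vi0; exists l; rewrite vE.
  by apply: contraNneq vil => v0; rewrite rXE v0 mulr0.
apply: contrapT => vij.
have vE2 l : rX v i l = (-1) ^+ e * rX v j l.
  rewrite !rXE; have -> : v 0 (mxvec_index i l) =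
    (-1) ^+ e * v 0 (mxvec_index j l).
    rewrite -!vE; apply/eqP; apply: contrapT => /negP h; apply: vij.
    by exists l.
  by rewrite rmorphM rmorphXn /= mulrN1z mulrCA.
have := lt_half i j e; rewrite gramE (negPf ij) subr0 mulr_sumr.
have [_ h1] := gramaa j.
rewrite (eq_bigr (fun l => rX v j l ^+ 2)) => [|l _]; first by lra.
by rewrite vE2 mulrA mulrA -expr2 sqrr_sign mul1r expr2.
Qed.

Lemma gram_sep (s : flag d M.*2) : (exists i : 'I_d.+1,
  ~ good M.*2.*2 (vert s i)) ->
  exists b a (e : bool), forall i : 'I_d.+1,
    8%:R^-1 < (-1) ^+ e * gram (rX (vert s i)) a b.
Proof.
case=> i /gram_bad[a [b [e ge]]]; exists b, a, e => j.
have : `|(-1) ^+ e * gram (rX (vert s i)) a b - (-1) ^+ e * gram (rX (vert s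
  j)) a b|
    <= 8%:R^-1.
  by rewrite -mulrBr normrM normrX normrN1 expr1n mul1r gram_step.
by rewrite ler_norml => /andP[_]; move: ge; lra.
Qed.

End GramSeparation.

(** * Compactness and continuity *)

Lemma compact_uniform (R : realType) D (B : R) (Pr : R -> 'rV[R]_D -> Prop) :
    (forall (e e' : R) x, 0 < e' <= e -> Pr e x -> Pr e' x) ->
    (forall x : 'rV[R]_D, (forall l, `|x 0 l| <= B) -> exists2 e, 0 < e &
       forall x' : 'rV[R]_D, (forall l, `|x' 0 l - x 0 l| < e) -> Pr e x') ->
  exists2 e, 0 < e & forall x : 'rV[R]_D, (forall l, `|x 0 l| <= B) -> Pr e x.
Proof.
move=> mono loc.
pose K := [set v : 'rV[R]_D | forall l, `[- B, B]%classic (v ord0 l)].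
have KP x : K x <-> forall l, `|x 0 l| <= B.
  by split=> h l; have := h l; rewrite /= in_itv /= ler_norml.
have Kc : compact K by apply: (@rV_compact _ _ (fun=> `[- B,
  B]%classic)) => l; exact: segment_compact.
have /compact_near_coveringP cov := Kc.
suff near0 : \forall e \near 0^'+, K `<=` Pr e.
  have pos : \forall e \near (0 : R)^'+, 0 < e by exact: nbhs_right_gt.
  have [e [e_gt0 eP]] := filter_ex (filterI pos near0).
  by exists e => // x /KP; exact: eP.
apply: (cov R (0^'+)) => x /KP /loc[e e_gt0 eP].
exists (ball x e, [set t : R | 0 < t < e]) => /=.
  split; first exact: nbhsx_ballx.
  by near=> t; apply/andP; split; near: t;
    [exact: nbhs_right_gt|exact: nbhs_right_lt].
case=> x' t [/= [_ bx] /andP[t0 te]]; apply: (mono e); first by rewrite t0 ltW.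
by apply: eP => l; have := bx 0 l; rewrite /ball /= distrC.
Unshelve. all: by end_near.
Qed.

(** Two radii are needed: [x'] is a nearby vertex of the grid and [x''] ranges over the other
    vertices of its alcove, so one functional serves the whole alcove. *)
Lemma pos_cvg_robust (R : realType) D (f : 'rV[R]_D -> R) (x : 'rV[R]_D) :
    f @ x --> f x -> 0 < f x ->
  exists2 e, 0 < e & forall x' : 'rV[R]_D, (forall l, `|x' 0 l - x 0 l| < e) ->
    forall x'' : 'rV[R]_D, (forall l, `|x'' 0 l - x' 0 l| <= e) -> e <= f x''.
Proof.
move=> fx fx_gt0; have f2 : 0 < f x / 2 by rewrite divr_gt0.
have /cvgr_dist_lt/(_ _ f2)/nbhs_ballP[e /= e_gt0 eP] := fx.
pose e' := Num.min (e / 2) (f x / 2).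
have e'0 : 0 < e' by rewrite lt_min divr_gt0.
exists e' => // x' xx' x'' x'x''; apply: (@le_trans _ _ (f x / 2)).
  by rewrite ge_min lexx orbT.
have e'e : e' <= e / 2 by rewrite ge_min lexx.
have : `|f x - f x''| < f x / 2.
  apply: eP; split=> // i l; rewrite [i]ord1 /ball /= distrC.
  rewrite -(subrK (x' 0 l) (x'' 0 l)) -addrA (le_lt_trans (ler_normD _ _)) //.
  by have := xx' l; have := x'x'' l; lra.
by rewrite ltr_norml => /andP[]; lra.
Qed.

Section EntrywiseContinuity.
Variables (R : realType) (T : Type) (F : set_system T).
Hypothesis FF : Filter F.

Definition ecvg m n (G : T -> 'M[R]_(m, n)) (A : 'M[R]_(m, n)) : Prop :=
  forall i j, (fun t => G t i j) @ F --> A i j.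

Lemma cvg_sumr (I : finType) (f : I -> T -> R) (a : I -> R) :
  (forall i, f i @ F --> a i) -> (fun t => \sum_i f i t) @ F --> \sum_i a i.
Proof. by move=> fa; apply: cvg_big => // ; exact: add_continuous. Qed.

Lemma ecvg_cst m n (A : 'M[R]_(m, n)) : ecvg (fun=> A) A.
Proof. by move=> i j; exact: cvg_cst. Qed.

Lemma ecvg_mul m n p (G : T -> 'M[R]_(m, n)) (H : T -> 'M[R]_(n, p)) A B :
  ecvg G A -> ecvg H B -> ecvg (fun t => G t *m H t) (A *m B).
Proof.
move=> GA HB i j; rewrite mxE.
under eq_fun do rewrite mxE.
by apply: cvg_sumr => l; exact: cvgM.
Qed.

Lemma ecvg_tr m n (G : T -> 'M[R]_(m, n)) A : ecvg G A ->
  ecvg (fun t => (G t)^T) A^T.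
Proof.
by move=> GA i j; rewrite mxE; under eq_fun do rewrite mxE; exact: GA.
Qed.

Lemma ecvg_lsub m n1 n2 (G : T -> 'M[R]_(m, n1 + n2)) A :
  ecvg G A -> ecvg (fun t => lsubmx (G t)) (lsubmx A).
Proof.
by move=> GA i j; rewrite mxE; under eq_fun do rewrite mxE; exact: GA.
Qed.

Lemma ecvg_rsub m n1 n2 (G : T -> 'M[R]_(m, n1 + n2)) A :
  ecvg G A -> ecvg (fun t => rsubmx (G t)) (rsubmx A).
Proof.
by move=> GA i j; rewrite mxE; under eq_fun do rewrite mxE; exact: GA.
Qed.

(** Only [X] has to converge: the other blocks are arbitrary, which covers points where the radial
    extension is not known to be continuous. *)
Lemma cvg_entry_gram k r n (X : T -> 'M[R]_(k, n)) A
    (Y : T -> 'M[R]_k) B (Z : T -> 'M[R]_(k, r)) C b i j :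
  ecvg X A ->
  (fun t => @entry_hom R k r b (inl (inl (i,
    j))) (frame_map (X t) (Y t) (Z t))) @ F -->
  (@entry_hom R k r b (inl (inl (i, j))) (frame_map A B C) : R).
Proof.
move=> XA; under eq_fun do rewrite entry_homE /entry /= mxE.
rewrite entry_homE /entry /= mxE; apply: cvgM; first exact: cvg_cst.
apply: cvgD; last exact: cvg_cst.
by apply: ecvg_mul => //; exact: ecvg_tr.
Qed.

Lemma cvg_entry k r n (X : T -> 'M[R]_(k, n)) A
    (Y : T -> 'M[R]_k) B (Z : T -> 'M[R]_(k, r)) C b x :
  ecvg X A -> ecvg Y B -> ecvg Z C ->
  (fun t => @entry_hom R k r b x (frame_map (X t) (Y t) (Z t))) @ F -->
  (@entry_hom R k r b x (frame_map A B C) : R).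
Proof.
move=> XA YB ZC; case: x => [[[i j]|[i j]]|[i j]].
- exact: cvg_entry_gram.
- under eq_fun do rewrite entry_homE /entry /= mxE.
  rewrite entry_homE /entry /= mxE; apply: cvgM; first exact: cvg_cst.
  by case: (i == j); [exact: cvg_cst | exact: YB].
under eq_fun do rewrite entry_homE /entry /=.
by rewrite entry_homE /entry /=; apply: cvgM; [exact: cvg_cst | exact: ZC].
Qed.

End EntrywiseContinuity.

Lemma ecvg_vec_mx (R : realType) k n (x : 'rV[R]_(k * n)) :
  ecvg (nbhs x) (fun y => vec_mx y) (vec_mx x).
Proof.
move=> i j; rewrite mxE; under eq_fun do rewrite mxE.
exact: coord_continuous.
Qed.

(** The left block is orthogonal and conjugates [D], whose eigenvalues are distinct, to a diagonal
    matrix; each of its rows is therefore a unit vector proportional to a coordinate vector. *)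
Lemma quad_zero (R : realType) k r (X : 'M[R]_(k, k + r)) : quad X = 0 ->
  exists g : sperm k, sR R g *m X = frame0 R k r.
Proof.
rewrite /quad /frame_map => X0.
have gram0 : X *m X^T - 1%:M = 0 by have := congr1 (fun w => w.1.1) X0.
have off0 : offdiag (lsubmx X *m diagD R k *m (lsubmx X)^T) = 0.
  by have := congr1 (fun w => w.1.2) X0.
have right0 : rsubmx X = 0 by have := congr1 (fun w => w.2) X0.
set A := lsubmx X in off0.
have XE : X = row_mx A 0 by rewrite -right0 hsubmxK.
clearbody A.
have AAT : A *m A^T = 1%:M.
  apply/eqP; rewrite -subr_eq0 -gram0 XE tr_row_mx mul_row_col mul0mx addr0.
  exact: eqxx.
have ATA : A^T *m A = 1%:M by exact: mulmx1C.
(* The entries of [A D = (A D A^T) A], where [A D A^T] is diagonal: row [i] of [A] is an eigenvector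
   of [D]. *)
have AE i j : A i j * j%:R = (A *m diagD R k *m A^T) i i * A i j.
  have -> : A i j * j%:R = (A *m diagD R k) i j by rewrite mul_mx_diag !mxE.
  transitivity ((A *m diagD R k *m A^T *m A) i j).
    by rewrite -mulmxA ATA mulmx1.
  rewrite mxE (bigD1 i) //= big1 ?addr0 // => l li.
  have /matrixP/(_ i l) := off0; rewrite mxE eq_sym (negPf li) => ->.
  by rewrite mxE mul0r.
have Auniq i j l : A i j != 0 -> A i l != 0 -> j = l.
  move=> Aij Ail; have := AE i j; rewrite mulrC => /(mulIf Aij) Ej.
  have := AE i l; rewrite mulrC => /(mulIf Ail); rewrite -Ej => /eqP.
  by rewrite eqr_nat => /eqP/val_inj.
have Asq i j : A i j != 0 -> A i j = 1 \/ A i j = -1.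
  move=> Aij; have /matrixP/(_ i i) := AAT.
  rewrite !mxE eqxx (bigD1 j) //= big1 => [|l lj].
    rewrite addr0 mxE -expr2 => /eqP; rewrite -[true%:R](expr1n _ 2) eqf_sqr.
    by case/orP => /eqP; [left|right].
  have -> : A i l = 0; last by rewrite mul0r.
  by apply/eqP; apply: contraNT lj => Ail; rewrite (Auniq _ _ _ Aij Ail).
pose P : 'M[int]_k := \matrix_(i,
  j) (if A i j == 0 then 0 else if A i j == 1 then 1 else -1).
have PA : map_mx intr P = A.
  apply/matrixP => i j; rewrite !mxE.
  case: eqP => [-> //|/eqP /Asq[->|->]]; first by rewrite eqxx.
  by case: eqP => [/eqP|_ //]; lra.
have PPT : P *m P^T == 1%:M.
  apply/eqP/matrixP => i j; apply: (@intr_inj R).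
  have /matrixP/(_ i j) := AAT; rewrite -PA map_trmx -map_mxM !mxE => ->.
  by case: (i == j).
exists (sperm_inv (exist (fun P : 'M[int]_k => P *m P^T == 1%:M) P PPT)).
by rewrite sR_inv /sR /= PA XE mul_mx_row ATA mulmx0.
Qed.

(** * Euclidean norm and radial extension *)

Section EuclideanNorm.
Variables (R : realType) (n : nat).
Implicit Types u v : 'rV[R]_n.

Lemma dotvZ a b u v : dotv (a *: u) (b *: v) = a * b * dotv u v.
Proof.
by rewrite /dotv mulr_sumr; apply: eq_bigr => i _; rewrite !mxE; ring.
Qed.

Lemma dotvv_ge0 u : 0 <= dotv u u.
Proof. by apply: sumr_ge0 => i _; rewrite -expr2 sqr_ge0. Qed.

Lemma norm_eucl_gt0 u : u != 0 -> 0 < norm_eucl u.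
Proof.
case/rV0Pn => j uj; rewrite sqrtr_gt0 /dotv (bigD1 j) //= ltr_pwDl //.
  by rewrite -expr2 exprn_even_gt0 //= uj.
by apply: sumr_ge0 => i _; rewrite -expr2 sqr_ge0.
Qed.

Lemma norm_euclZ a u : norm_eucl (a *: u) = `|a| * norm_eucl u.
Proof.
by rewrite /norm_eucl dotvZ sqrtrM -?expr2 ?sqr_ge0 // sqrtr_sqr.
Qed.

Lemma usphereP u : usphere R n u <-> dotv u u = 1.
Proof.
rewrite /usphere /= /norm_eucl; split=> [u1|->]; last exact: sqrtr1.
by rewrite -(sqr_sqrtr (dotvv_ge0 u)) u1 expr1n.
Qed.

Lemma usphere_normalize u : u != 0 -> usphere R n ((norm_eucl u)^-1 *: u).
Proof.
move=> u0; rewrite /usphere /= norm_euclZ ger0_norm ?invr_ge0 ?sqrtr_ge0 //.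
by rewrite mulVf // gt_eqF // norm_eucl_gt0.
Qed.

Lemma cvg_norm_eucl u : @norm_eucl R n @ u --> norm_eucl u.
Proof.
apply: (cvg_comp (fun v => dotv v v) Num.sqrt); last exact: sqrt_continuous.
by apply: (@cvg_sumr _ _ _ (nbhs_filter u)) => i; apply: cvgM;
  exact: coord_continuous.
Qed.

Lemma cvg_rV (T : Type) (F : set_system T) (G : T -> 'rV[R]_n) u : Filter F ->
  ecvg F G u -> G @ F --> u.
Proof.
move=> FF Gu; apply/cvg_ballP => e e_gt0.
have : \forall t \near F, forall j, ball (u 0 j) e (G t 0 j).
  apply: filter_forall => j; have /cvg_ballP := Gu 0 j; exact.
by apply: filterS => t Gt; split=> // i j; rewrite [i]ord1.
Qed.

End EuclideanNorm.

Section RadialExtension.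
Variables (R : realType) (n m : nat) (psi : 'rV[R]_n -> 'rV[R]_m).
Hypotheses (psi_cont : {within usphere R n, continuous psi})
  (psi_odd : forall x, usphere R n x -> psi (- x) = - psi x).

(** The value 0 at the origin makes the extension odd everywhere, so that equivariance holds for all
    matrices; continuity is only claimed at points of the sphere. *)
Definition radial (u : 'rV[R]_n) : 'rV[R]_m :=
  if u == 0 then 0 else psi ((norm_eucl u)^-1 *: u).

Lemma radial_sign (s : int) u : s = 1 \/ s = -1 ->
  radial (s%:~R *: u) = s%:~R *: radial u.
Proof.
case=> ->; rewrite ?mulr1z ?scale1r // mulrN1z !scaleN1r /radial oppr_eq0.
case: eqP => [_|/eqP u0]; first by rewrite oppr0.
have -> : norm_eucl (- u) = norm_eucl u.
  by rewrite -scaleN1r norm_euclZ normrN1 mul1r.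
by rewrite scalerN psi_odd //; exact: usphere_normalize.
Qed.

Lemma usphere_neq0 u : usphere R n u -> u != 0.
Proof.
move/usphereP => u1; apply: contra_eq_neq u1 => ->.
by rewrite /dotv big1 => [|i _]; rewrite ?mxE ?mul0r // eq_sym oner_eq0.
Qed.

Lemma radial_usphere u : usphere R n u -> radial u = psi u.
Proof.
move=> u1; rewrite /radial (negPf (usphere_neq0 u1)).
by move: u1; rewrite /usphere /= => ->; rewrite invr1 scale1r.
Qed.

Lemma cvg_radial u : usphere R n u -> radial @ u --> psi u.
Proof.
move=> u1; have u0 := usphere_neq0 u1.
have FFu : Filter (nbhs u) := nbhs_filter u.
have nu : norm_eucl u = 1 by [].
have normalize : (fun v => (norm_eucl v)^-1 *: v) @ u --> u.
  rewrite -[X in _ --> X](_ : (norm_eucl u)^-1 *: u = u); last first.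
    by rewrite nu invr1 scale1r.
  apply: (@cvgZ _ _ _ _ (nbhs_filter u)); last exact: cvg_id.
  apply: (@cvgV _ _ _ (nbhs_filter u) (@norm_eucl R n));
    first by rewrite nu oner_eq0.
  exact: cvg_norm_eucl.
have near0 : \forall v \near u, v != 0.
  have /cvgr_gt/(_ 0) := @cvg_norm_eucl R n u; rewrite nu ltr01 => /(_ isT).
  apply: filterS => v; apply: contraTneq => ->.
  by rewrite /norm_eucl /dotv big1 ?sqrtr0 ?ltxx // => i _; rewrite mxE mul0r.
have /subspace_continuousP/(_ u u1) pu := psi_cont.
apply/cvg_ballP => e e_gt0.
have pb : nbhs u [set t | usphere R n t -> ball (psi u) e (psi t)].
  exact: (pu _ (nbhsx_ballx (psi u) e e_gt0)).
have h : \forall v \near u, usphere R n ((norm_eucl v)^-1 *: v) ->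
    ball (psi u) e (psi ((norm_eucl v)^-1 *: v)).
  exact: (normalize _ pb).
near=> v.
have v0 : v != 0 by near: v.
rewrite /radial (negPf v0); apply: (near h v) => //.
exact: usphere_normalize.
Unshelve. all: by end_near.
Qed.

End RadialExtension.

(** * The frame theorem *)

Lemma annihilator_mx (R : fieldType) m r (L : {vspace 'rV[R]_m}) :
  (\dim L + r = m)%N ->
  exists N : 'M[R]_(m, r), forall u, u *m N = 0 -> u \in L.
Proof.
move=> dL; have dC : \dim L^C = r.
  by rewrite dimv_compl dimvf /dim /= mul1n -[X in (X - _)%N]dL addKn.
(* Coordinates of the projection onto a complement of [L], along [L]. *)
pose f (u : 'rV[R]_m) : 'rV[R]_r :=
  \row_j coord (vbasis L^C) (cast_ord (esym dC) j) (daddv_pi L^C L u).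
have f_lin : linear f.
  by move=> a u v; apply/rowP => j; rewrite !mxE linearP linearP.
pose fL : {linear 'rV[R]_m -> 'rV[R]_r} :=
  HB.pack f (GRing.isLinear.Build R _ _ _ f f_lin).
exists (lin1_mx fL) => u; rewrite mul_rV_lin1 => fu0.
have CL : (L^C :&: L = 0)%VS by rewrite capvC capv_compl.
have CLf : (L^C + L = fullv)%VS by rewrite addvC addv_complf.
have piC0 : daddv_pi L^C L u = 0.
  have piC : daddv_pi L^C L u \in (L^C)%VS by exact: memv_pi.
  rewrite (coord_vbasis piC) big1 // => i _.
  have /rowP/(_ (cast_ord dC i)) := fu0; rewrite !mxE cast_ordK => ->.
  by rewrite scale0r.
have := daddv_pi_add CL (_ : u \in (L^C + L)%VS).
by rewrite CLf memvf piC0 add0r => /(_ isT) <-; exact: memv_pi.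
Qed.

Section FrameTheorem.
Variables (R : realType) (m k r : nat) (psi : 'rV[R]_(k + r) -> 'rV[R]_m).
Hypotheses (k_gt0 : (0 < k)%N)
  (psi_sphere : forall x, usphere R (k + r) x -> usphere R m (psi x))
  (psi_cont : {within usphere R (k + r), continuous psi})
  (psi_odd : forall x, usphere R (k + r) x -> psi (- x) = - psi x).
Variables (L : {vspace 'rV[R]_m}) (N : 'M[R]_(m, r)).
Hypothesis N_L : forall u, u *m N = 0 -> u \in L.
Local Notation n := (k + r)%N.
Local Notation d := (k * (k + r))%N.
Local Notation W := ('M[R]_k * 'M[R]_k * 'M[R]_(k, r))%type.

Definition radial_rows (X : 'M[R]_(k, n)) : 'M[R]_(k, m) :=
  \matrix_i radial psi (row i X).

Definition frame_eqn (X : 'M[R]_(k, n)) : W :=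
  frame_map X (radial_rows X *m (radial_rows X)^T) (radial_rows X *m N).

Lemma radial_rows_sR (g : sperm k) X :
  radial_rows (sR R g *m X) = sR R g *m radial_rows X.
Proof.
have [p [s gps]] := signed_perm_exists g; have [_ s1 _] := gps.
apply/matrixP => i j; rewrite (sR_mulE _ _ _ gps) !mxE.
have -> : row i (sR R g *m X) = (s i)%:~R *: row (p i) X.
  by apply/rowP => l; rewrite mxE (sR_mulE _ _ _ gps) !mxE.
by rewrite radial_sign // mxE.
Qed.

Lemma frame_eqn_sR g X : frame_eqn (sR R g *m X) = actT R r g (frame_eqn X).
Proof.
by rewrite /frame_eqn actT_frame_map radial_rows_sR trmx_mul !mulmxA.
Qed.

Lemma frame_eqn_in X : frame_eqn X \in targetU R k r.
Proof. by apply: frame_map_in; rewrite trmx_mul trmxK. Qed.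

Lemma mul_trE p q (X : 'M[R]_(p, q)) i j : (X *m X^T) i j =
  dotv (row i X) (row j X).
Proof. by rewrite mxE; apply: eq_bigr => l _; rewrite !mxE. Qed.

Lemma frame_eqn0 X : frame_eqn X = 0 -> exists e : 'I_k -> 'rV[R]_n,
  [/\ orthonormal_frame e, orthonormal_frame (fun i => psi (e i)) &
      forall i, psi (e i) \in L].
Proof.
move=> X0; exists (fun i => row i X).
have gram0 : X *m X^T - 1%:M = 0 by have := congr1 (fun w => w.1.1) X0.
have off0 : offdiag (radial_rows X *m (radial_rows X)^T) = 0.
  by have := congr1 (fun w => w.1.2) X0.
have N0 : radial_rows X *m N = 0 by have := congr1 (fun w => w.2) X0.
have ortho : orthonormal_frame (fun i => row i X).
  move=> i j; rewrite -mul_trE; have /eqP := gram0; rewrite subr_eq0 => /eqP ->.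
  by rewrite mxE.
have unit i : usphere R n (row i X) by apply/usphereP; rewrite ortho eqxx.
have rowE i : row i (radial_rows X) = psi (row i X).
  by rewrite rowK radial_usphere.
split=> // [i j|i]; last by apply: N_L; rewrite -rowE -row_mul N0 row0.
case: (eqVneq i j) => [<-|ij]; first by apply/usphereP/psi_sphere.
have /matrixP/(_ i j) := off0; rewrite mxE (negPf ij) mul_trE !rowE => ->.
by rewrite mxE.
Qed.

Lemma ecvg_radial_rows (x : 'rV[R]_d) :
  (forall i, usphere R n (row i (vec_mx x))) ->
  ecvg (nbhs x) (fun y => radial_rows (vec_mx y)) (radial_rows (vec_mx x)).
Proof.
move=> ux i j; rewrite mxE radial_usphere //; under eq_fun do rewrite mxE.
have FFx : Filter (nbhs x) := nbhs_filter x.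
apply: (@cvg_comp _ _ _ (fun y => radial psi (row i (vec_mx y))) (fun v =>
  v 0 j)
  _ (nbhs (psi (row i (vec_mx x))))).
  apply: (@cvg_comp _ _ _ (fun y => row i (vec_mx y)) (radial psi)
    _ (nbhs (row i (vec_mx x)))).
    apply: cvg_rV => a l.
    have rowE y : row i (vec_mx y) a l = vec_mx y i l :> R by rewrite mxE.
    by rewrite rowE; under eq_fun do rewrite rowE; exact: ecvg_vec_mx.
  exact: cvg_radial.
exact: coord_continuous.
Qed.

Definition robust (f : 'M[R]_(k, n) -> W) (e : R) (x : 'rV[R]_d) : Prop :=
  exists b z, forall x' : 'rV[R]_d, (forall l, `|x' 0 l - x 0 l| <= e) ->
    e <= @entry_hom R k r b z (f (vec_mx x')).

Lemma robust_le f (e e' : R) x : 0 < e' <= e -> robust f e x -> robust f e' x.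
Proof.
move=> /andP[_ e'e] [b [z h]]; exists b, z => x' xx'; apply: (le_trans e'e).
by apply: h => l; apply: le_trans e'e.
Qed.

(** Where the rows are orthonormal, [psi] is continuous and any positive signed coordinate is
    stable. Elsewhere a Gram entry is nonzero, and its stability does not involve [psi]. *)
Lemma robust_frame_eqn :
    (forall X, frame_eqn X != 0) ->
  exists2 e, 0 < e & forall x : 'rV[R]_d, (forall l, `|x 0 l| <= 3%:R) ->
    robust frame_eqn e x.
Proof.
move=> no0; apply: compact_uniform => [e e' x|x _]; first exact: robust_le.
have FFx : Filter (nbhs x) := nbhs_filter x.
have [b [z [fx fcvg]]] : exists b z,
  0 < @entry_hom R k r b z (frame_eqn (vec_mx x)) :> R /\
    (fun y => @entry_hom R k r b z (frame_eqn (vec_mx y)) : R) @ x -->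
    (@entry_hom R k r b z (frame_eqn (vec_mx x)) : R).
  have [gram0|gramN0] := eqVneq (vec_mx x *m (vec_mx x)^T - 1%:M) 0.
    have [b [z fx]] := entry_pos (no0 (vec_mx x)).
    exists b, z; split=> //.
    have rows : ecvg (nbhs x) (fun y =>
      radial_rows (vec_mx y)) (radial_rows (vec_mx x)).
      apply: ecvg_radial_rows => i; apply/usphereP; rewrite -mul_trE.
      by have /eqP := gram0; rewrite subr_eq0 => /eqP ->; rewrite mxE eqxx.
    apply: cvg_entry; first exact: ecvg_vec_mx.
      by apply: ecvg_mul => //; exact: ecvg_tr.
    by apply: ecvg_mul => //; exact: ecvg_cst.
  have [i [j gij]] : exists i j, (vec_mx x *m (vec_mx x)^T - 1%:M) i j != 0.
    apply: contrapT => nij; move/eqP: gramN0; apply; apply/matrixP => i j.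
    by rewrite [RHS]mxE; apply/eqP; apply: contrapT => /negP h; apply: nij;
      exists i, j.
  exists ((vec_mx x *m (vec_mx x)^T - 1%:M) i j < 0), (inl (inl (i, j))); split.
    rewrite entry_homE /entry /=; move: gij; move: (_ i j) => t t0.
    have [t_lt0|t_ge0] := ltrP t 0; first by rewrite mulN1r oppr_gt0.
    by rewrite mul1r lt_neqAle eq_sym t0.
  by apply: cvg_entry_gram; exact: ecvg_vec_mx.
have [e e_gt0 h] := pos_cvg_robust fcvg fx.
by exists e => // x' xx'; exists b, z; exact: h.
Qed.

Lemma robust_quad (del : R) : 0 < del ->
  exists2 e, 0 < e & forall x : 'rV[R]_d, (forall l, `|x 0 l| <= 3%:R) ->
    (exists g : sperm k, forall i j,
      `|(sR R g *m vec_mx x - frame0 R k r) i j| < del) \/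
    robust (@quad R k r) e x.
Proof.
move=> del_gt0; apply: compact_uniform => [e e' x e'P|x _].
  by case=> [?|h]; [left | right; exact: robust_le h].
have FFx : Filter (nbhs x) := nbhs_filter x.
have [q0|qN0] := eqVneq (quad (vec_mx x)) 0.
  have [g gx] := quad_zero q0; exists del => // x' xx'; left; exists g.
  rewrite -gx -mulmxBr; apply: sR_norm_le => i j.
  by rewrite !mxE; exact: xx'.
have [b [z fx]] := entry_pos qN0.
have fcvg : (fun y => @entry_hom R k r b z (quad (vec_mx y)) : R) @ x -->
    (@entry_hom R k r b z (quad (vec_mx x)) : R).
  have Xc := @ecvg_vec_mx R k n x.
  apply: cvg_entry; [exact: Xc | | exact: ecvg_rsub Xc].
  apply: ecvg_mul; last exact: ecvg_tr (ecvg_lsub Xc).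
  by apply: ecvg_mul; [exact: ecvg_lsub Xc | exact: ecvg_cst].
have [e e_gt0 h] := pos_cvg_robust fcvg fx.
by exists e => // x' xx'; right; exists b, z; exact: h.
Qed.

Lemma mesh_small (mu : R) : 0 < mu -> exists2 M, (0 < M)%N & mesh R M <= mu.
Proof.
move=> mu_gt0; pose M := (Num.Def.archi_bound mu^-1).+1.
exists M => //; rewrite /mesh -[leRHS]invrK lef_pV2 ?posrE ?invr_gt0 ?ltr0n //.
have mu0 : 0 <= mu^-1 by rewrite invr_ge0 ltW.
apply: (le_trans (ltW (archi_boundP mu0))); rewrite ler_nat /M; lia.
Qed.

Definition grid_row M (v : 'rV[int]_d) : 'rV[R]_d := mesh R M *: map_mx intr v.

Lemma vec_grid_row M v : vec_mx (grid_row M v) = rX R M v.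
Proof. by apply/matrixP => i j; rewrite rXE !mxE. Qed.

Lemma frame_exists : exists e : 'I_k -> 'rV[R]_n,
  [/\ orthonormal_frame e, orthonormal_frame (fun i => psi (e i)) &
      forall i, psi (e i) \in L].
Proof.
apply: contrapT => none.
have no0 X : frame_eqn X != 0 by apply/eqP => /frame_eqn0; exact: none.
have [e1 e1_gt0 rob1] := robust_frame_eqn no0.
have rad0 := radius_gt0 R r k_gt0.
have rad1 := radius_le R r k_gt0.
have [e0 e0_gt0 rob0] := robust_quad rad0.
have n0 : 0 < 48%:R * n%:R :> R by rewrite mulr_gt0 ?ltr0n // addn_gt0 k_gt0.
(* In this order: an alcove fits in the robustness balls of both systems, it is small against the
   affine zone, and Gram entries vary by at most 1/8 on it, with [48 = 6 * 8]. *)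
pose mu := Num.min (Num.min e0 e1) (Num.min (radius R k r / 8%:R) (48%:R *
  n%:R)^-1).
have [M M_gt0 mesh_mu] : exists2 M, (0 < M)%N & mesh R M <= mu.
  by apply: mesh_small; rewrite !lt_min e0_gt0 e1_gt0 divr_gt0 // invr_gt0.
have m0 := mesh_gt0 R M_gt0.
have [mesh_e0 mesh_e1 mesh_rad mesh_n] : [/\ mesh R M <= e0, mesh R M <= e1,
    mesh R M <= radius R k r / 8%:R & mesh R M <= (48%:R * n%:R)^-1].
  by move: mesh_mu; rewrite !le_min => /andP[/andP[? ?] /andP[? ?]].
have mesh6 : 6%:R * n%:R * mesh R M <= 8%:R^-1.
  move: mesh_n; rewrite -[(48%:R * _)^-1]mul1r ler_pdivlMr //; lra.
have D0 : 0 < d.+1%:R :> R by rewrite ltr0n.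
have k0 : 0 < k.+1%:R :> R by rewrite ltr0n.
(* The perturbation must stay below both robustness bounds, below the Gram separation 1/8, and below
   what locating the zero of the base map tolerates. *)
pose e := Num.min (Num.min (e0 / 2) (e1 / 2))
  (Num.min 8%:R^-1 (mesh R M * (8%:R^-1 / d.+1%:R) / k.+1%:R)).
have e_gt0 : 0 < e.
  have i8 : 0 < 8%:R^-1 :> R by rewrite invr_gt0.
  by rewrite !lt_min i8 !divr_gt0 // mulr_gt0 // divr_gt0.
have [e_e0 e_e1 e_8 e_mesh] : [/\ e < e0, e < e1, e <= 8%:R^-1 &
    k.+1%:R * e <= mesh R M * (8%:R^-1 / d.+1%:R)].
  have : e <= e by []; rewrite {2}/e !le_min => /andP[/andP[? ?] /andP[? h]].
  by split; [lra|lra|by []|rewrite mulrC -ler_pdivlMr].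
have row_le (s : flag d M.*2) i l : `|grid_row M (vert s i) 0 l| <= 3%:R.
  case/mxvec_indexP: l => a l; have := rX_le3 M_gt0 mesh6 s i a l.
  by rewrite -vec_grid_row mxE.
have row_step (s : flag d M.*2) i j l :
    `|grid_row M (vert s i) 0 l - grid_row M (vert s j) 0 l| <= mesh R M.
  case/mxvec_indexP: l => a l; have := rX_step R M_gt0 s i j a l.
  by rewrite -!vec_grid_row !mxE.
have bad_far (s : flag d M.*2) : (exists i : 'I_d.+1,
  ~ good M.*2.*2 (vert s i)) ->
    forall i : 'I_d.+1, ~ exists g, close_at M (radius R k r) g (vert s i).
  move=> [j bad] i [g gi]; apply: bad; apply: (close_at_good M_gt0 (g := g)).
  have gj : close_at M (radius R k r + mesh R M) g (vert s j).
    exact: close_spread gi.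
  by move=> a l; apply: lt_le_trans (gj a l) _; lra.
pose f (b : bool) (v : 'rV[int]_d) : W :=
  if b then frame_eqn (rX R M v) else basemap M (radius R k r) v.
have f_in b v : good M.*2.*2 v -> f b v \in targetU R k r.
  by move=> _; case: b; [exact: frame_eqn_in | exact: basemap_in].
have f_equiv b g v : good M.*2.*2 v -> f b (actD g v) = actT R r g (f b v).
  move=> _; case: b; first by rewrite /f rX_actD frame_eqn_sR.
  by apply: (basemap_actD M_gt0); lra.
have f_sep (s : flag d M.*2) : (exists i : 'I_d.+1,
  ~ good M.*2.*2 (vert s i)) ->
    exists h : 'Hom(W, R^o), (forall w, `|h w| <= `|w|) /\
      forall b (i : 'I_d.+1), e < h (f b (vert s i)).
  move=> bad; have [a [b [c sep]]] := gram_sep M_gt0 mesh6 bad.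
  exists (@entry_hom R k r c (inl (inl (b, a)))); split;
    first exact: entry_hom_le.
  move=> [] i; rewrite entry_homE; apply: (le_lt_trans e_8); first exact: sep.
  by rewrite /f (basemap_far (bad_far s bad i)); exact: sep.
have far (s : flag d M.*2) :
    (forall i : 'I_d.+1, ~ exists g, close_at M (radius R k r) g (vert s i)) ->
    exists h : 'Hom(W, R^o), (forall w, `|h w| <= `|w|) /\
      forall i : 'I_d.+1, e < h (quad (rX R M (vert s i))).
  move=> nclose; have [|[g gs]|[b [z h]]] := rob0 (grid_row M (vert s 0)).
  - by move=> l; exact: row_le.
  - by case: (nclose ord0); exists g; move: gs; rewrite vec_grid_row.
  exists (@entry_hom R k r b z); split=> [w|i]; first exact: entry_hom_le.
  apply: (lt_le_trans e_e0); rewrite -vec_grid_row; apply: h => l.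
  by apply: le_trans mesh_e0; exact: row_step.
have base (F : 'rV[int]_d -> W) : (forall v, `|F v - f false v| <= e) ->
    (forall v, good M.*2.*2 v -> F v \in targetU R k r) ->
    exists2 s0 : flag d M.*2,
      pos_dep xpredT (fun i : 'I_d.+1 => F (vert s0 i)) &
      forall s : flag d M.*2, pos_dep xpredT (fun i : 'I_d.+1 =>
        F (vert s i)) ->
        exists g, forall i : 'I_d.+1, vert s i = actD g (vert s0 i).
  move=> Ff F_in; exists (zero_flag0 k r M).
    exact: (zero_flag0_exists k_gt0 M_gt0 mesh_rad e_mesh Ff F_in).
  by move=> s; apply: (zero_flag0_uniq k_gt0 M_gt0 mesh_rad e_mesh Ff far).
have [s [w [w_le [c [c_gt0 c_dep]]]]] :=
  zero_flag_transfer (grid_dim_gt0 r k_gt0)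
  (dim_targetU R k r) (fun w : W => normr_ge0 w) (fun a (w : W) => normrZ a w)
  (fun u w : W => ler_normD u w) (@actD1 k n) (@actDM k n) (@actDV k n)
  (@actDB k n) (@actTM R k r) (@actT_inj R k r) (@actT_in R k r)
  (@actT_le R k r) (@good_free k n M.*2.*2) (fun g v =>
    @good_actD k n M.*2.*2 g v)
  (fun v (gv : good M.*2.*2 v) => let: And3 h _ _ := gv in h)
  (@n_odd_actD k n) (@n_odd_vert k n M.*2) e_gt0 f_in f_equiv f_sep base.
(* The contradiction: one signed coordinate is at least [e1] on the whole alcove, above the noise
   [e], so it is positive on every term of a vanishing sum. *)
have [b [z rob]] := rob1 (grid_row M (vert s 0)) (row_le s 0%N).
have hc (i : 'I_d.+1) : 0 < @entry_hom R k r b z (c i *: (f true (vert s i) +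
  w i)) :> R.
  suff hp : 0 < @entry_hom R k r b z (f true (vert s i) + w i) :> R.
    by rewrite linearZ; apply: mulr_gt0 hp; exact: c_gt0.
  have hD x y : @entry_hom R k r b z (x + y) =
      @entry_hom R k r b z x + @entry_hom R k r b z y :> R by rewrite linearD.
  rewrite hD; have := le_trans (entry_hom_le b z (w i)) (w_le i).
  rewrite ler_norml => /andP[+ _].
  have : e1 <= @entry_hom R k r b z (f true (vert s i)).
    rewrite /f -vec_grid_row; apply: rob => l.
    by apply: le_trans mesh_e1; exact: row_step.
  by move: e_e1; lra.
have : @entry_hom R k r b z (\sum_i c i *: (f true (vert s i) + w i)) == 0.
  by rewrite c_dep linear0.
rewrite linear_sum gt_eqF // (bigD1 ord0) //=.
apply: ltr_pwDl; first exact: hc.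
by apply: sumr_ge0 => i _; exact/ltW/hc.
Qed.

End FrameTheorem.

Theorem theorem8 (R : realType) (n m k : nat)
    (hn : (1 <= n)%N) (hm : (1 <= m)%N) (hk1 : (1 <= k)%N) (hkn : (k <= n)%N)
    (psi : 'rV[R]_n -> 'rV[R]_m)
    (psi_sphere : forall x, usphere R n x -> usphere R m (psi x))
    (psi_cont : {within usphere R n, continuous psi})
    (psi_odd : forall x, usphere R n x -> psi (- x) = - psi x)
    (L : {vspace 'rV[R]_m}) (hL : (\dim L + (n - k) = m)%N) :
  exists e : 'I_k -> 'rV[R]_n,
    [/\ orthonormal_frame e,
        orthonormal_frame (fun i => psi (e i)) &
        forall i : 'I_k, psi (e i) \in L].
Proof.
have [N N_L] := annihilator_mx hL.
move: (n - k)%N (esym (subnKC hkn)) N N_L => r nE N N_L; subst n.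
exact: frame_exists N_L.
Qed.
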